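(* Let $K$ be a field with $\mathrm{char}(K)\neq 2$, let $m\geq 1$, and let $\mathfrak{h}=\mathfrak{n}_{m,2}$ be the free nilpotent Lie algebra over $K$ of rank $m$ and class $2$. Then $L(\mathfrak{h})$ is free nilpotent of rank $m+\binom{m}{2}$ and class $2$. In particular, $$\dim \chi(\mathfrak{h}) = 2k+\binom{k}{2},\qquad \text{where } k=m+\binom{m}{2},$$ and $\chi(\mathfrak{h})$ is nilpotent of class exactly $4$ if $m\geq 3$.
   Context: For a Lie algebra $\mathfrak{g}$ over $K$, let $\mathfrak{g}^{\psi}$ be an isomorphic copy of $\mathfrak{g}$ via $x\mapsto x^{\psi}$, and let $\chi(\mathfrak{g})=\langle \mathfrak{g},\mathfrak{g}^{\psi} \mid [x,x^{\psi}]=0 \text{ for all } x\in\mathfrak{g}\rangle$ (the quotient of the free product of the Lie algebras $\mathfrak{g}$ and $\mathfrak{g}^{\psi}$ by the ideal generated by all $[x,x^{\psi}]$). Let $\alpha:\chi(\mathfrak{g})\to\mathfrak{g}$ be the homomorphism with $\alpha(x)=\alpha(x^{\psi})=x$ for all $x\in\mathfrak{g}$, and $L(\mathfrak{g})=\ker(\alpha)$. The free nilpotent Lie algebra of rank $r$ and class $c$ is $\mathfrak{n}_{r,c}=F/\gamma_{c+1}(F)$, where $F$ is a free Lie algebra of rank $r$ over $K$ and $\gamma_1(F)=F$, $\gamma_{k+1}(F)=[F,\gamma_k(F)]$. *)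

(* Defs.v *)
From HB Require Import structures.
From mathcomp Require Import all_boot all_order all_algebra.
From mathcomp Require Import generic_quotient.
From mathcomp Require Import boolp.
Set Implicit Arguments.
Unset Strict Implicit.
Unset Printing Implicit Defensive.
Import GRing.Theory.
Local Open Scope ring_scope.
Local Open Scope quotient_scope.

Reserved Notation "[< x , y >]" (at level 0, x, y at level 99,
  format "[<  x ,  y  >]").
Reserved Notation "{ 'lie' U -> V }" (at level 0, U at level 98, V at level 99,
  format "{ 'lie'  U  ->  V }").

HB.mixin Record Lmodule_isLieAlgebra (K : fieldType) V of GRing.Lmodule K V := {
  lbr : V -> V -> V;
  lbr_linearl : forall a x y z,
    lbr (a *: x + y) z = a *: lbr x z + lbr y z;
  lbr_linearr : forall a x y z,
    lbr z (a *: x + y) = a *: lbr z x + lbr z y;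
  lbrxx : forall x, lbr x x = 0;
  lbr_jacobi : forall x y z,
    lbr x (lbr y z) + lbr y (lbr z x) + lbr z (lbr x y) = 0
}.

#[short(type="lieAlgType")]
HB.structure Definition LieAlgebra (K : fieldType) :=
  {V of Lmodule_isLieAlgebra K V & GRing.Lmodule K V}.

Notation "[< x , y >]" := (lbr x y) : ring_scope.

HB.mixin Record isLieMorphism (K : fieldType) (U V : lieAlgType K)
    (f : U -> V) := {
  lie_morph_subproof : {morph f : x y / [< x, y >]}
}.

#[short(type="lieMorphism")]
HB.structure Definition LieMorphism (K : fieldType) (U V : lieAlgType K) :=
  {f of isLieMorphism K U V f & @GRing.Linear K U V *:%R f}.

Notation "{ 'lie' U -> V }" := (lieMorphism U%type V%type) : type_scope.

Definition lie_isomorphic (K : fieldType) (U V : lieAlgType K) : Prop :=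
  exists f : {lie U -> V}, bijective f.

Section LieTheory.
Variables (K : fieldType).

Section Bracket.
Variable V : lieAlgType K.
Implicit Types (x y z : V) (a : K).

Lemma lbrDl x y z : [< x + y, z >] = [< x, z >] + [< y, z >].
Proof. by have := lbr_linearl 1 x y z; rewrite !scale1r. Qed.

Lemma lbrDr z x y : [< z, x + y >] = [< z, x >] + [< z, y >].
Proof. by have := lbr_linearr 1 x y z; rewrite !scale1r. Qed.

Lemma lbr0l z : [< 0, z >] = 0.
Proof. by apply: (addrI [< 0, z >]); rewrite -lbrDl !addr0. Qed.

Lemma lbr0r z : [< z, 0 >] = 0.
Proof. by apply: (addrI [< z, 0 >]); rewrite -lbrDr !addr0. Qed.

Lemma lbrZl a x z : [< a *: x, z >] = a *: [< x, z >].
Proof. by have := lbr_linearl a x 0 z; rewrite lbr0l !addr0. Qed.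

Lemma lbrZr a z x : [< z, a *: x >] = a *: [< z, x >].
Proof. by have := lbr_linearr a x 0 z; rewrite lbr0r !addr0. Qed.

Lemma lbrC x y : [< x, y >] = - [< y, x >].
Proof.
apply/eqP; rewrite -addr_eq0; apply/eqP.
by have := lbrxx (x + y); rewrite lbrDl !lbrDr !lbrxx add0r addr0.
Qed.

Lemma lbrNl x z : [< - x, z >] = - [< x, z >].
Proof. by rewrite -scaleN1r lbrZl scaleN1r. Qed.

Lemma lbrNr z x : [< z, - x >] = - [< z, x >].
Proof. by rewrite -scaleN1r lbrZr scaleN1r. Qed.

Lemma lbrBl x y z : [< x - y, z >] = [< x, z >] - [< y, z >].
Proof. by rewrite lbrDl lbrNl. Qed.

Lemma lbrBr z x y : [< z, x - y >] = [< z, x >] - [< z, y >].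
Proof. by rewrite lbrDr lbrNr. Qed.

End Bracket.

Lemma lie_morphE (U V : lieAlgType K) (f : {lie U -> V}) x y :
  f [< x, y >] = [< f x, f y >].
Proof. exact: lie_morph_subproof. Qed.

HB.instance Definition _ (V : lieAlgType K) :=
  isLieMorphism.Build K V V idfun (fun _ _ => erefl).

Record lieIdeal (V : lieAlgType K) := LieIdeal {
  ideal_pred :> V -> Prop;
  ideal0 : ideal_pred 0;
  ideal_linear : forall (a : K) (x y : V),
    ideal_pred x -> ideal_pred y -> ideal_pred (a *: x + y);
  ideal_lbr : forall x y : V, ideal_pred y -> ideal_pred [< x, y >]
}.

Section IdealTheory.
Variables (V : lieAlgType K) (I : lieIdeal V).

Lemma idealD x y : I x -> I y -> I (x + y).
Proof. by move=> Ix Iy; rewrite -[x]scale1r; apply: ideal_linear. Qed.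

Lemma idealZ a x : I x -> I (a *: x).
Proof. by move=> Ix; rewrite -[_ *: x]addr0; apply/ideal_linear/ideal0. Qed.

Lemma idealN x : I x -> I (- x).
Proof. by rewrite -scaleN1r; apply: idealZ. Qed.

Lemma ideal_lbrl x y : I x -> I [< x, y >].
Proof. by move=> Ix; rewrite lbrC; apply/idealN/ideal_lbr. Qed.

End IdealTheory.

Section GeneratedIdeal.
Variables (V : lieAlgType K) (S : V -> Prop).

Definition ideal_gen_pred (x : V) : Prop :=
  forall I : lieIdeal V, (forall y, S y -> I y) -> I x.

Fact ideal_gen0 : ideal_gen_pred 0. Proof. by move=> I _; apply: ideal0. Qed.

Fact ideal_gen_linear (a : K) (x y : V) :
  ideal_gen_pred x -> ideal_gen_pred y -> ideal_gen_pred (a *: x + y).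
Proof. by move=> Sx Sy I SI; apply: ideal_linear; [apply: Sx | apply: Sy]. Qed.

Fact ideal_gen_lbr (x y : V) : ideal_gen_pred y -> ideal_gen_pred [< x, y >].
Proof. by move=> Sy I SI; apply/ideal_lbr/Sy. Qed.

Definition ideal_gen : lieIdeal V :=
  LieIdeal ideal_gen0 ideal_gen_linear ideal_gen_lbr.

Lemma ideal_gen_sub x : S x -> ideal_gen x.
Proof. by move=> Sx I; apply. Qed.

End GeneratedIdeal.

Section Quotient.
Variables (V : lieAlgType K) (I : lieIdeal V).
Implicit Types (a b : K) (x y z : V).

Definition ideal_eqv x y := `[< I (x - y) >].

Fact ideal_eqv_equiv : equiv_class_of ideal_eqv.
Proof.
split=> [x|x y|y x z].
- by apply/asboolP; rewrite subrr; apply: ideal0.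
- by apply/asboolP/asboolP => /idealN; rewrite opprB.
- move=> /asboolP xy /asboolP yz; apply/asboolP.
  by rewrite -[x](subrK y) -addrA; apply: idealD.
Qed.

Canonical ideal_equiv := EquivRelPack ideal_eqv_equiv.
Canonical ideal_encModRel := defaultEncModRel ideal_eqv.

Definition lieQuot := {eq_quot ideal_eqv}.
HB.instance Definition _ := EqQuotient.on lieQuot.
HB.instance Definition _ := Choice.on lieQuot.

Local Notation pi := (\pi_lieQuot).

Lemma lieQuot_eq x y : pi x = pi y <-> I (x - y).
Proof. by split=> [/eqmodP /asboolP|Ixy] //; apply/eqmodP/asboolP. Qed.

Lemma lieQuot_reprB x : I (repr (pi x) - x).
Proof. by apply/lieQuot_eq; rewrite reprK. Qed.

Definition lieQuot_add := lift_op2 lieQuot +%R.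
Definition lieQuot_opp := lift_op1 lieQuot -%R.
Definition lieQuot_scale a := lift_op1 lieQuot ( *:%R a).
Definition lieQuot_lbr := lift_op2 lieQuot (@lbr K V).

Fact lieQuot_addE x y : lieQuot_add (pi x) (pi y) = pi (x + y).
Proof.
unlock lieQuot_add; apply/lieQuot_eq; rewrite opprD addrACA.
by apply: idealD; apply: lieQuot_reprB.
Qed.

Fact lieQuot_oppE x : lieQuot_opp (pi x) = pi (- x).
Proof.
unlock lieQuot_opp; apply/lieQuot_eq; rewrite -opprD.
exact/idealN/lieQuot_reprB.
Qed.

Fact lieQuot_scaleE a x : lieQuot_scale a (pi x) = pi (a *: x).
Proof.
unlock lieQuot_scale; apply/lieQuot_eq; rewrite -scalerBr.
exact/idealZ/lieQuot_reprB.
Qed.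

Fact lieQuot_lbrE x y : lieQuot_lbr (pi x) (pi y) = pi [< x, y >].
Proof.
unlock lieQuot_lbr; apply/lieQuot_eq.
rewrite -[_ - _](subrKA [< x, repr (pi y) >]).
rewrite -lbrBl -lbrBr.
by apply: idealD; [apply: ideal_lbrl | apply: ideal_lbr]; apply: lieQuot_reprB.
Qed.

Fact lieQuot_addA : associative lieQuot_add.
Proof.
elim/quotW=> x; elim/quotW=> y; elim/quotW=> z.
by rewrite !lieQuot_addE addrA.
Qed.

Fact lieQuot_addC : commutative lieQuot_add.
Proof. by elim/quotW=> x; elim/quotW=> y; rewrite !lieQuot_addE addrC. Qed.

Fact lieQuot_add0 : left_id (pi 0) lieQuot_add.
Proof. by elim/quotW=> x; rewrite lieQuot_addE add0r. Qed.

Fact lieQuot_addN : left_inverse (pi 0) lieQuot_opp lieQuot_add.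
Proof. by elim/quotW=> x; rewrite lieQuot_oppE lieQuot_addE addNr. Qed.

HB.instance Definition _ := GRing.isZmodule.Build lieQuot
  lieQuot_addA lieQuot_addC lieQuot_add0 lieQuot_addN.

Fact lieQuot_piD x y : pi x + pi y = pi (x + y) :> lieQuot.
Proof. exact: lieQuot_addE. Qed.

Fact lieQuot_scaleA a b p :
  lieQuot_scale a (lieQuot_scale b p) = lieQuot_scale (a * b) p.
Proof. by elim/quotW: p => x; rewrite !lieQuot_scaleE scalerA. Qed.

Fact lieQuot_scale1 : left_id 1 lieQuot_scale.
Proof. by elim/quotW=> x; rewrite lieQuot_scaleE scale1r. Qed.

Fact lieQuot_scaleDr : right_distributive lieQuot_scale +%R.
Proof.
move=> a; elim/quotW=> x; elim/quotW=> y.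
by rewrite !(lieQuot_piD, lieQuot_scaleE) scalerDr.
Qed.

Fact lieQuot_scaleDl p : {morph lieQuot_scale^~ p : a b / a + b}.
Proof.
move=> a b; elim/quotW: p => x.
by rewrite !lieQuot_scaleE lieQuot_piD scalerDl.
Qed.

HB.instance Definition _ := GRing.Zmodule_isLmodule.Build K lieQuot
  lieQuot_scaleA lieQuot_scale1 lieQuot_scaleDr lieQuot_scaleDl.

Fact lieQuot_pi_linear : linear (pi : V -> lieQuot).
Proof. by move=> a x y; rewrite -lieQuot_addE -lieQuot_scaleE. Qed.

Fact lieQuot_lbr_linearl a (p q r : lieQuot) :
  lieQuot_lbr (a *: p + q) r = a *: lieQuot_lbr p r + lieQuot_lbr q r.
Proof.
elim/quotW: p => x; elim/quotW: q => y; elim/quotW: r => z.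
by rewrite -lieQuot_pi_linear !lieQuot_lbrE lbr_linearl lieQuot_pi_linear.
Qed.

Fact lieQuot_lbr_linearr a (p q r : lieQuot) :
  lieQuot_lbr r (a *: p + q) = a *: lieQuot_lbr r p + lieQuot_lbr r q.
Proof.
elim/quotW: p => x; elim/quotW: q => y; elim/quotW: r => z.
by rewrite -lieQuot_pi_linear !lieQuot_lbrE lbr_linearr lieQuot_pi_linear.
Qed.

Fact lieQuot_lbrxx p : lieQuot_lbr p p = 0.
Proof. by elim/quotW: p => x; rewrite lieQuot_lbrE lbrxx. Qed.

Fact lieQuot_jacobi p q r :
  lieQuot_lbr p (lieQuot_lbr q r) + lieQuot_lbr q (lieQuot_lbr r p)
  + lieQuot_lbr r (lieQuot_lbr p q) = 0.
Proof.
elim/quotW: p => x; elim/quotW: q => y; elim/quotW: r => z.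
by rewrite !lieQuot_lbrE !lieQuot_piD lbr_jacobi.
Qed.

HB.instance Definition _ := Lmodule_isLieAlgebra.Build K lieQuot
  lieQuot_lbr_linearl lieQuot_lbr_linearr lieQuot_lbrxx lieQuot_jacobi.

Definition quot_pi (x : V) : lieQuot := pi x.

Fact quot_pi_lbr : {morph quot_pi : x y / [< x, y >]}.
Proof. by move=> x y; rewrite -[LHS]lieQuot_lbrE. Qed.

HB.instance Definition _ := GRing.isLinear.Build K V lieQuot *:%R quot_pi
  lieQuot_pi_linear.
HB.instance Definition _ := isLieMorphism.Build K V lieQuot quot_pi quot_pi_lbr.

Lemma quot_piE x y : quot_pi x = quot_pi y <-> I (x - y).
Proof. exact: lieQuot_eq. Qed.

Lemma quot_pi_surj (p : lieQuot) : exists x, p = quot_pi x.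
Proof. by elim/quotW: p => x; exists x. Qed.

Section Lift.
Variables (W : lieAlgType K) (f : {lie V -> W}).
Hypothesis fI : forall x, I x -> f x = 0.

Definition quot_lift_fun (p : lieQuot) : W := f (repr p).

Fact quot_lift_funE x : quot_lift_fun (quot_pi x) = f x.
Proof.
by apply/eqP; rewrite -subr_eq0 -raddfB; apply/eqP/fI/lieQuot_reprB.
Qed.

Fact quot_lift_linear : linear quot_lift_fun.
Proof.
move=> a p q; have [[x ->] [y ->]] := (quot_pi_surj p, quot_pi_surj q).
by rewrite -linearP !quot_lift_funE linearP.
Qed.

Fact quot_lift_lbr : {morph quot_lift_fun : p q / [< p, q >]}.
Proof.
move=> p q; have [[x ->] [y ->]] := (quot_pi_surj p, quot_pi_surj q).
by rewrite -lie_morphE !quot_lift_funE lie_morphE.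
Qed.

HB.instance Definition _ := GRing.isLinear.Build K lieQuot W *:%R quot_lift_fun
  quot_lift_linear.
HB.instance Definition _ := isLieMorphism.Build K lieQuot W quot_lift_fun
  quot_lift_lbr.

Definition quot_lift : {lie lieQuot -> W} := quot_lift_fun.

Lemma quot_liftE x : quot_lift (quot_pi x) = f x.
Proof. exact: quot_lift_funE. Qed.

End Lift.
End Quotient.

Section LowerCentralSeries.
Variable V : lieAlgType K.

(* [lbr_span S] is [V, S], the linear span of the brackets [x, s]. *)
Inductive lbr_span (S : V -> Prop) : V -> Prop :=
| lbr_span0 : lbr_span S 0
| lbr_span_lbr (a : K) x s u : S s -> lbr_span S u ->
    lbr_span S (a *: [< x, s >] + u).

(* The index is shifted: [lcs n] is gamma_(n + 1). *)
Fixpoint lcs (n : nat) : V -> Prop :=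
  if n is n'.+1 then lbr_span (lcs n') else fun=> True.

Fact lbr_span_linear (S : V -> Prop) (a : K) x y :
  lbr_span S x -> lbr_span S y -> lbr_span S (a *: x + y).
Proof.
move=> Sx Sy; elim: Sx => [|b z s u Ss _ IH]; first by rewrite scaler0 add0r.
by rewrite scalerDr scalerA -addrA; apply: lbr_span_lbr.
Qed.

Fact lcs0 n : lcs n 0. Proof. by case: n => // n; apply: lbr_span0. Qed.

Fact lcs_linear n (a : K) x y : lcs n x -> lcs n y -> lcs n (a *: x + y).
Proof. by case: n => // n; apply: lbr_span_linear. Qed.

Fact lcs_lbr n x y : lcs n y -> lcs n [< x, y >].
Proof.
elim: n x y => // n IH x y; elim=> [|a z s u ls _ IHu].
  by rewrite lbr0r; apply: lbr_span0.
by rewrite lbr_linearr; apply: lbr_span_lbr; first apply: IH.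
Qed.

Definition lcs_ideal n : lieIdeal V :=
  LieIdeal (lcs0 n) (@lcs_linear n) (@lcs_lbr n).

Definition nilpotent_le (c : nat) : Prop := forall x, lcs c x -> x = 0.

Definition nilpotency_class (c : nat) : Prop :=
  nilpotent_le c /\ forall d, (d < c)%N -> ~ nilpotent_le d.

End LowerCentralSeries.

(* The free Lie algebra on [X] is the type of formal Lie expressions in the
   elements of [X], modulo the congruence generated by the axioms of Lie
   algebras over [K]; [free_lift] is its universal property. *)

Section Free.
Variable X : Type.

Inductive lie_term : Type :=
| LVar of X
| LZero
| LAdd of lie_term & lie_term
| LScale of K & lie_term
| LBr of lie_term & lie_term.

Inductive lie_eq : lie_term -> lie_term -> Prop :=
| LEq_refl t : lie_eq t t
| LEq_sym t u : lie_eq t u -> lie_eq u t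
| LEq_trans t u v : lie_eq t u -> lie_eq u v -> lie_eq t v
| LEq_add t t' u u' : lie_eq t t' -> lie_eq u u' ->
    lie_eq (LAdd t u) (LAdd t' u')
| LEq_scale a t t' : lie_eq t t' -> lie_eq (LScale a t) (LScale a t')
| LEq_br t t' u u' : lie_eq t t' -> lie_eq u u' ->
    lie_eq (LBr t u) (LBr t' u')
| LEq_addA t u v : lie_eq (LAdd t (LAdd u v)) (LAdd (LAdd t u) v)
| LEq_addC t u : lie_eq (LAdd t u) (LAdd u t)
| LEq_add0 t : lie_eq (LAdd LZero t) t
| LEq_addN t : lie_eq (LAdd (LScale (-1) t) t) LZero
| LEq_scaleA a b t : lie_eq (LScale a (LScale b t)) (LScale (a * b) t)
| LEq_scale1 t : lie_eq (LScale 1 t) t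
| LEq_scaleDr a t u :
    lie_eq (LScale a (LAdd t u)) (LAdd (LScale a t) (LScale a u))
| LEq_scaleDl a b t :
    lie_eq (LScale (a + b) t) (LAdd (LScale a t) (LScale b t))
| LEq_brl a t u v : lie_eq (LBr (LAdd (LScale a t) u) v)
    (LAdd (LScale a (LBr t v)) (LBr u v))
| LEq_brr a t u v : lie_eq (LBr v (LAdd (LScale a t) u))
    (LAdd (LScale a (LBr v t)) (LBr v u))
| LEq_brxx t : lie_eq (LBr t t) LZero
| LEq_jacobi t u v : lie_eq
    (LAdd (LAdd (LBr t (LBr u v)) (LBr u (LBr v t))) (LBr v (LBr t u))) LZero.

HB.instance Definition _ := gen_eqMixin lie_term.
HB.instance Definition _ := gen_choiceMixin lie_term.

Definition lie_eqv t u := `[< lie_eq t u >].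

Fact lie_eqv_equiv : equiv_class_of lie_eqv.
Proof.
split=> [t|t u|u t v]; first by apply/asboolP/LEq_refl.
  by apply/asboolP/asboolP => /LEq_sym.
by move=> /asboolP tu /asboolP uv; apply/asboolP/(LEq_trans tu).
Qed.

Canonical lie_equiv := EquivRelPack lie_eqv_equiv.
Canonical lie_encModRel := defaultEncModRel lie_eqv.

Definition freeLie := {eq_quot lie_eqv}.
HB.instance Definition _ := EqQuotient.on freeLie.
HB.instance Definition _ := Choice.on freeLie.

Local Notation pi := (\pi_freeLie).

Lemma freeLie_eq t u : pi t = pi u <-> lie_eq t u.
Proof. by split=> [/eqmodP /asboolP|tu] //; apply/eqmodP/asboolP. Qed.

Fact freeLie_repr t : lie_eq (repr (pi t)) t.
Proof. by apply/freeLie_eq; rewrite reprK. Qed.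

Definition freeLie_add := lift_op2 freeLie LAdd.
Definition freeLie_scale a := lift_op1 freeLie (LScale a).
Definition freeLie_opp := freeLie_scale (-1).
Definition freeLie_lbr := lift_op2 freeLie LBr.

Fact freeLie_addE t u : freeLie_add (pi t) (pi u) = pi (LAdd t u).
Proof.
by unlock freeLie_add; apply/freeLie_eq/LEq_add; apply: freeLie_repr.
Qed.

Fact freeLie_scaleE a t : freeLie_scale a (pi t) = pi (LScale a t).
Proof.
by unlock freeLie_scale; apply/freeLie_eq/LEq_scale/freeLie_repr.
Qed.

Fact freeLie_lbrE t u : freeLie_lbr (pi t) (pi u) = pi (LBr t u).
Proof.
by unlock freeLie_lbr; apply/freeLie_eq/LEq_br; apply: freeLie_repr.
Qed.

Definition freeLieE := (freeLie_addE, freeLie_scaleE, freeLie_lbrE).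

Fact freeLie_addA : associative freeLie_add.
Proof.
elim/quotW=> t; elim/quotW=> u; elim/quotW=> v.
by rewrite !freeLieE; apply/freeLie_eq/LEq_addA.
Qed.

Fact freeLie_addC : commutative freeLie_add.
Proof.
by elim/quotW=> t; elim/quotW=> u; rewrite !freeLieE; apply/freeLie_eq/LEq_addC.
Qed.

Fact freeLie_add0 : left_id (pi LZero) freeLie_add.
Proof. by elim/quotW=> t; rewrite freeLieE; apply/freeLie_eq/LEq_add0. Qed.

Fact freeLie_addN : left_inverse (pi LZero) freeLie_opp freeLie_add.
Proof.
by elim/quotW=> t; rewrite /freeLie_opp !freeLieE; apply/freeLie_eq/LEq_addN.
Qed.

HB.instance Definition _ := GRing.isZmodule.Build freeLie
  freeLie_addA freeLie_addC freeLie_add0 freeLie_addN.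

Fact freeLie_piD t u : pi t + pi u = pi (LAdd t u) :> freeLie.
Proof. exact: freeLie_addE. Qed.

Fact freeLie_scaleA a b p :
  freeLie_scale a (freeLie_scale b p) = freeLie_scale (a * b) p.
Proof.
by elim/quotW: p => t; rewrite !freeLieE; apply/freeLie_eq/LEq_scaleA.
Qed.

Fact freeLie_scale1 : left_id 1 freeLie_scale.
Proof. by elim/quotW=> t; rewrite freeLieE; apply/freeLie_eq/LEq_scale1. Qed.

Fact freeLie_scaleDr : right_distributive freeLie_scale +%R.
Proof.
move=> a; elim/quotW=> t; elim/quotW=> u.
rewrite !(freeLie_piD, freeLieE).
exact/freeLie_eq/LEq_scaleDr.
Qed.

Fact freeLie_scaleDl p : {morph freeLie_scale^~ p : a b / a + b}.
Proof.
move=> a b; elim/quotW: p => t; rewrite !freeLieE freeLie_piD.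
exact/freeLie_eq/LEq_scaleDl.
Qed.

HB.instance Definition _ := GRing.Zmodule_isLmodule.Build K freeLie
  freeLie_scaleA freeLie_scale1 freeLie_scaleDr freeLie_scaleDl.

Fact freeLie_piP a t u : a *: pi t + pi u = pi (LAdd (LScale a t) u) :> freeLie.
Proof. by rewrite -freeLie_addE -freeLie_scaleE. Qed.

Fact freeLie_lbr_linearl a (p q r : freeLie) :
  freeLie_lbr (a *: p + q) r = a *: freeLie_lbr p r + freeLie_lbr q r.
Proof.
elim/quotW: p => t; elim/quotW: q => u; elim/quotW: r => v.
by rewrite !(freeLie_piP, freeLie_lbrE); apply/freeLie_eq/LEq_brl.
Qed.

Fact freeLie_lbr_linearr a (p q r : freeLie) :
  freeLie_lbr r (a *: p + q) = a *: freeLie_lbr r p + freeLie_lbr r q.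
Proof.
elim/quotW: p => t; elim/quotW: q => u; elim/quotW: r => v.
by rewrite !(freeLie_piP, freeLie_lbrE); apply/freeLie_eq/LEq_brr.
Qed.

Fact freeLie_lbrxx p : freeLie_lbr p p = 0.
Proof. by elim/quotW: p => t; rewrite freeLieE; apply/freeLie_eq/LEq_brxx. Qed.

Fact freeLie_jacobi p q r :
  freeLie_lbr p (freeLie_lbr q r) + freeLie_lbr q (freeLie_lbr r p)
  + freeLie_lbr r (freeLie_lbr p q) = 0.
Proof.
elim/quotW: p => t; elim/quotW: q => u; elim/quotW: r => v.
by rewrite !(freeLieE, freeLie_piD); apply/freeLie_eq/LEq_jacobi.
Qed.

HB.instance Definition _ := Lmodule_isLieAlgebra.Build K freeLie
  freeLie_lbr_linearl freeLie_lbr_linearr freeLie_lbrxx freeLie_jacobi.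

Definition free_var (x : X) : freeLie := pi (LVar x).

Lemma freeLie_ind (P : freeLie -> Prop) :
    (forall x, P (free_var x)) -> P 0 ->
    (forall a p q, P p -> P q -> P (a *: p + q)) ->
    (forall p q, P p -> P q -> P [< p, q >]) ->
  forall p, P p.
Proof.
move=> PX P0 Plin Pbr; elim/quotW.
elim=> [x||t Pt u Pu|a t Pt|t Pt u Pu]; [exact: PX | exact: P0 | | |].
- by rewrite -freeLie_piD -[pi t]scale1r; apply: Plin.
- by rewrite -freeLie_scaleE -[freeLie_scale _ _]addr0; apply: Plin.
- by rewrite -freeLie_lbrE; apply: Pbr.
Qed.

Section Lift.
Variables (W : lieAlgType K) (f : X -> W).

Fixpoint lie_eval (t : lie_term) : W :=
  match t with
  | LVar x => f x
  | LZero => 0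
  | LAdd t u => lie_eval t + lie_eval u
  | LScale a t => a *: lie_eval t
  | LBr t u => [< lie_eval t, lie_eval u >]
  end.

Lemma lie_eval_eq t u : lie_eq t u -> lie_eval t = lie_eval u.
Proof.
elim=> //=; try by move=> *; congruence.
- by move=> *; rewrite addrA.
- by move=> *; rewrite addrC.
- by move=> *; rewrite add0r.
- by move=> *; rewrite scaleN1r addNr.
- by move=> *; rewrite scalerA.
- by move=> *; rewrite scale1r.
- by move=> *; rewrite scalerDr.
- by move=> *; rewrite scalerDl.
- by move=> *; rewrite lbr_linearl.
- by move=> *; rewrite lbr_linearr.
- by move=> *; rewrite lbrxx.
- by move=> *; rewrite lbr_jacobi.
Qed.

Definition free_lift_fun (p : freeLie) : W := lie_eval (repr p).

Fact free_lift_funE t : free_lift_fun (pi t) = lie_eval t.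
Proof. exact/lie_eval_eq/freeLie_repr. Qed.

Fact free_lift_linear : linear free_lift_fun.
Proof.
move=> a; elim/quotW=> t; elim/quotW=> u.
by rewrite freeLie_piP !free_lift_funE.
Qed.

Fact free_lift_lbr : {morph free_lift_fun : p q / [< p, q >]}.
Proof.
elim/quotW=> t; elim/quotW=> u.
by rewrite [X in free_lift_fun X]freeLie_lbrE !free_lift_funE.
Qed.

HB.instance Definition _ := GRing.isLinear.Build K freeLie W *:%R free_lift_fun
  free_lift_linear.
HB.instance Definition _ := isLieMorphism.Build K freeLie W free_lift_fun
  free_lift_lbr.

Definition free_lift : {lie freeLie -> W} := free_lift_fun.

Lemma free_liftE x : free_lift (free_var x) = f x.
Proof. exact: free_lift_funE. Qed.

End Lift.
End Free.

Section Kernel.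
Variables (U V : lieAlgType K) (f : {lie U -> V}).

Fact lieKer0 : f 0 = 0. Proof. exact: raddf0. Qed.

Fact lieKer_linear (a : K) x y : f x = 0 -> f y = 0 -> f (a *: x + y) = 0.
Proof. by move=> fx fy; rewrite linearP /= fx fy scaler0 addr0. Qed.

Fact lieKer_lbrr x y : f y = 0 -> f [< x, y >] = 0.
Proof. by move=> fy; rewrite lie_morphE fy lbr0r. Qed.

Definition lieKer_ideal : lieIdeal U :=
  LieIdeal lieKer0 lieKer_linear lieKer_lbrr.

Record lieKer := LieKer { lieKer_val : U; _ : f lieKer_val == 0 }.

HB.instance Definition _ := [isSub for lieKer_val].
HB.instance Definition _ := [Choice of lieKer by <:].

Fact lieKer_closed : subsemimod_closed (fun x => f x == 0).
Proof.
split; first split; rewrite ?unfold_in ?raddf0 // => x y; rewrite !unfold_in.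
  by move=> /eqP fx /eqP fy; rewrite raddfD /= fx fy addr0.
by move=> /eqP fy; rewrite linearZ_LR /= fy scaler0.
Qed.

HB.instance Definition _ := GRing.SubChoice_isSubLmodule.Build K U
  (fun x => f x == 0) lieKer lieKer_closed.

Lemma lieKer_inj : injective lieKer_val. Proof. exact: val_inj. Qed.

Fact lieKer_lbr_subproof (x y : lieKer) : f [< val x, val y >] == 0.
Proof. by rewrite lie_morphE (eqP (valP x)) lbr0l. Qed.

Definition lieKer_lbr (x y : lieKer) : lieKer :=
  LieKer (lieKer_lbr_subproof x y).

Fact lieKer_lbr_linearl (a : K) (x y z : lieKer) :
  lieKer_lbr (a *: x + y) z = a *: lieKer_lbr x z + lieKer_lbr y z.
Proof. by apply: lieKer_inj; rewrite /= lbr_linearl. Qed.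

Fact lieKer_lbr_linearr (a : K) (x y z : lieKer) :
  lieKer_lbr z (a *: x + y) = a *: lieKer_lbr z x + lieKer_lbr z y.
Proof. by apply: lieKer_inj; rewrite /= lbr_linearr. Qed.

Fact lieKer_lbrxx x : lieKer_lbr x x = 0.
Proof. by apply: lieKer_inj; rewrite /= lbrxx. Qed.

Fact lieKer_jacobi x y z :
  lieKer_lbr x (lieKer_lbr y z) + lieKer_lbr y (lieKer_lbr z x)
  + lieKer_lbr z (lieKer_lbr x y) = 0.
Proof. by apply: lieKer_inj; rewrite /= lbr_jacobi. Qed.

HB.instance Definition _ := Lmodule_isLieAlgebra.Build K lieKer
  lieKer_lbr_linearl lieKer_lbr_linearr lieKer_lbrxx lieKer_jacobi.

End Kernel.

Section FreeProduct.
Variables U V : lieAlgType K.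

Local Notation F := (freeLie (U + V)).
Local Notation vl x := (free_var (inl x : (U + V)%type)).
Local Notation vr x := (free_var (inr x : (U + V)%type)).

Inductive free_prod_rel : F -> Prop :=
| FPRel_linl (a : K) (x y : U) :
    free_prod_rel (vl (a *: x + y) - (a *: vl x + vl y))
| FPRel_lbrl (x y : U) : free_prod_rel (vl [< x, y >] - [< vl x, vl y >])
| FPRel_linr (a : K) (x y : V) :
    free_prod_rel (vr (a *: x + y) - (a *: vr x + vr y))
| FPRel_lbrr (x y : V) : free_prod_rel (vr [< x, y >] - [< vr x, vr y >]).

Definition freeProd : lieAlgType K := lieQuot (ideal_gen free_prod_rel).

Definition fprod_inl (x : U) : freeProd := quot_pi _ (vl x).
Definition fprod_inr (x : V) : freeProd := quot_pi _ (vr x).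

Fact fprod_inl_linear : linear fprod_inl.
Proof.
move=> a x y; rewrite /fprod_inl -linearP; apply/quot_piE/ideal_gen_sub.
exact: FPRel_linl.
Qed.

Fact fprod_inl_lbr : {morph fprod_inl : x y / [< x, y >]}.
Proof.
move=> x y; rewrite /fprod_inl -lie_morphE; apply/quot_piE/ideal_gen_sub.
exact: FPRel_lbrl.
Qed.

Fact fprod_inr_linear : linear fprod_inr.
Proof.
move=> a x y; rewrite /fprod_inr -linearP; apply/quot_piE/ideal_gen_sub.
exact: FPRel_linr.
Qed.

Fact fprod_inr_lbr : {morph fprod_inr : x y / [< x, y >]}.
Proof.
move=> x y; rewrite /fprod_inr -lie_morphE; apply/quot_piE/ideal_gen_sub.
exact: FPRel_lbrr.
Qed.

HB.instance Definition _ := GRing.isLinear.Build K U freeProd *:%R fprod_inl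
  fprod_inl_linear.
HB.instance Definition _ := isLieMorphism.Build K U freeProd fprod_inl
  fprod_inl_lbr.
HB.instance Definition _ := GRing.isLinear.Build K V freeProd *:%R fprod_inr
  fprod_inr_linear.
HB.instance Definition _ := isLieMorphism.Build K V freeProd fprod_inr
  fprod_inr_lbr.

Section Lift.
Variables (W : lieAlgType K) (f : {lie U -> W}) (g : {lie V -> W}).

Definition fprod_case (u : U + V) : W :=
  match u with inl x => f x | inr y => g y end.

Fact fprod_case_rel (p : F) :
  ideal_gen free_prod_rel p -> free_lift fprod_case p = 0.
Proof.
move=> /(_ (lieKer_ideal (free_lift fprod_case))); apply.
move=> _ [a x y|x y|a x y|x y] /=; rewrite raddfB /=.
- by rewrite linearP /= !free_liftE /= linearP subrr.
- by rewrite lie_morphE /= !free_liftE /= lie_morphE subrr.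
- by rewrite linearP /= !free_liftE /= linearP subrr.
- by rewrite lie_morphE /= !free_liftE /= lie_morphE subrr.
Qed.

Definition fprod_lift : {lie freeProd -> W} := quot_lift fprod_case_rel.

Lemma fprod_liftl x : fprod_lift (fprod_inl x) = f x.
Proof. by rewrite /fprod_lift quot_liftE free_liftE. Qed.

Lemma fprod_liftr y : fprod_lift (fprod_inr y) = g y.
Proof. by rewrite /fprod_lift quot_liftE free_liftE. Qed.

End Lift.
End FreeProduct.

Section Chi.
Variable G : lieAlgType K.

(* The copy g^psi is the right-hand factor of the free product. *)
Inductive chi_rel : freeProd G G -> Prop :=
| Chi_rel (x : G) : chi_rel [< fprod_inl G x, fprod_inr G x >].

Definition chi : lieAlgType K := lieQuot (ideal_gen chi_rel).

Definition chi_id (x : G) : chi := quot_pi _ (fprod_inl G x).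
Definition chi_psi (x : G) : chi := quot_pi _ (fprod_inr G x).

Definition fprod_fold : {lie freeProd G G -> G} := fprod_lift idfun idfun.

Fact fprod_fold_chi (p : freeProd G G) :
  ideal_gen chi_rel p -> fprod_fold p = 0.
Proof.
move=> /(_ (lieKer_ideal fprod_fold)); apply.
move=> _ [x]; apply: etrans (lie_morphE _ _ _) _.
by rewrite fprod_liftl fprod_liftr lbrxx.
Qed.

Definition chi_alpha : {lie chi -> G} := quot_lift fprod_fold_chi.

Lemma chi_alpha_id x : chi_alpha (chi_id x) = x.
Proof. by rewrite /chi_alpha quot_liftE fprod_liftl. Qed.

Lemma chi_alpha_psi x : chi_alpha (chi_psi x) = x.
Proof. by rewrite /chi_alpha quot_liftE fprod_liftr. Qed.

Definition chiL : lieAlgType K := lieKer chi_alpha.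

End Chi.
End LieTheory.

(* [lcs c] is gamma_(c + 1), hence this is F / gamma_(c + 1)(F). *)
Definition freeNil (K : fieldType) (r c : nat) : lieAlgType K :=
  lieQuot (lcs_ideal (freeLie K 'I_r) c).

(* [Vector.axiom n V] is the type of linear bijections from [V] to ['rV_n]. *)
Definition has_dim (K : fieldType) (V : lmodType K) (n : nat) : Prop :=
  inhabited (Vector.axiom n V).

(* Main.v *)
Require Import Defs.
From HB Require Import structures.
From mathcomp Require Import all_boot all_order all_algebra.
From mathcomp Require Import boolp ring.

(** Write [i] and [j] for the two copies of [g] in [chi g], and put
    [p = (i + j) / 2] and [q = (j - i) / 2], so that [L g] is the ideal
    generated by the [q x].  Polarizing [[i x, j x] = 0] gives
    [[i x, j y] = [j x, i y]], and from this
      [[p x, q y] = q [x, y] / 2]   and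
      [[p x, p y] = p [x, y] - [q x, q y]].
    Two consequences follow.  First, [p g] normalizes the subalgebra generated
    by [q g], so that [chi g] is the sum of [p g] and of that subalgebra; as
    [alpha (p x) = x] and [alpha (q x) = 0], the sum is direct and the
    subalgebra is [L g] ([chi_span], [chi_split_bij]).  Second, expanding
    [[q x, [p y, p z]]] yields [[q x, [q y, q z]] = q [x, [y, z]] / 4]
    ([chi_qqq]), which vanishes as soon as [g] has class at most 2.  Hence, for
    a basis [b] of [g] with [k] elements, sending the generators to the [q b_i]
    defines a morphism from the free nilpotent algebra of rank [k] and class 2
    onto [L g].

    It is injective because no further relation holds.  The two formulas above
    suggest a multiplication on [g + g + V (x) V], where [V] is the space [g]
    ([model_lbr]): the first two summands play [p g] and [q g], and
    [[q x, q y]] is the alternating tensor [x ^ y].  When [g] has class at most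
    2 this is a Lie algebra ([model_jacobi]), it receives a morphism from
    [chi g], and the images of the [q b_i] and of their brackets
    [[q b_i, q b_j]], [i < j], are linearly independent there
    ([model_comb_inj]).  Applied to an abelian [g], the same computation shows
    that the generators of a free nilpotent algebra of class 2 and their
    brackets form a basis, whence the dimensions.

    The tensor model is nilpotent of class at most 4, by a short computation of
    its lower central series, and [chi g] embeds into it ([chi_nilpotent]).
    Conversely [q [x, y] = 2 [p x, q y]] is a commutator, so that
    [[q [x, y], q [x, z]]] lies in the fourth term of the lower central series;
    its image in the model is [[x, y] ^ [x, z]], which is nonzero as soon as
    [[x, y]] and [[x, z]] are linearly independent ([chi_not_nilpotent]).  Such
    [x, y, z] exist in the free nilpotent algebra of class 2 from rank 3 on. *)

Set Implicit Arguments.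
Unset Strict Implicit.
Unset Printing Implicit Defensive.
Import GRing.Theory.
Local Open Scope ring_scope.

(** * Lie brackets, morphisms and the lower central series *)

Section LieComplements.
Variables (K : fieldType).

Lemma scale_half (V : lmodType K) (v : V) :
  2 != 0 :> K -> 2^-1 *: (v + v) = v.
Proof. by move=> two_neq0; rewrite -[v]scale1r -scalerDl scalerA mulVf. Qed.

HB.instance Definition _ (V : lieAlgType K) (z : V) :=
  GRing.isLinear.Build K V V *:%R (lbr z) (fun a x y => lbr_linearr a x y z).

Lemma lbr_sumr (V : lieAlgType K) (z : V) (I : finType) (f : I -> V) :
  [< z, \sum_i f i >] = \sum_i [< z, f i >].
Proof. by rewrite linear_sum. Qed.

Lemma lbr_suml (V : lieAlgType K) (z : V) (I : finType) (f : I -> V) :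
  [< \sum_i f i, z >] = \sum_i [< f i, z >].
Proof.
by rewrite lbrC lbr_sumr -sumrN; apply: eq_bigr => i _; rewrite -lbrC.
Qed.

(** Jacobi's identity in its Leibniz form: [lbr x] is a derivation. *)
Lemma lbrA (V : lieAlgType K) (x y z : V) :
  [< x, [< y, z >] >] = [< [< x, y >], z >] + [< y, [< x, z >] >].
Proof.
have := lbr_jacobi x y z; rewrite [ [< z, x >] ]lbrC lbrNr [ [< z, _ >] ]lbrC.
by move=> /eqP; rewrite -addrA -opprD subr_eq0 addrC => /eqP.
Qed.

Lemma lie_isomorphic_sym (U V : lieAlgType K) :
  lie_isomorphic U V -> lie_isomorphic V U.
Proof.
move=> [f [g fK gK]].
have glin : linear g.
  move=> a x y; apply: (can_inj fK).
  by rewrite linearP /= !gK.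
have glbr : {morph g : x y / [< x, y >]}.
  by move=> x y; apply: (can_inj fK); rewrite lie_morphE !gK.
pose g1 := HB.pack_for {lie V -> U} g (GRing.isLinear.Build K V U *:%R g glin)
  (isLieMorphism.Build K V U g glbr).
by exists g1; exists f.
Qed.

(** Nilpotency of class at most 2, as an identity that rewrites. *)
Definition nil2 (V : lieAlgType K) := forall x y z : V, [< x, [< y, z >] >] = 0.

Lemma lbr_span_ind (V : lieAlgType K) (S P : V -> Prop) :
    P 0 -> (forall a x y, P x -> P y -> P (a *: x + y)) ->
    (forall x s, S s -> P [< x, s >]) ->
  forall x, lbr_span S x -> P x.
Proof. by move=> P0 Pl Pb x; elim=> // a y s u Ss _ Pu; apply/Pl/Pu/Pb. Qed.

Lemma lcs_br (V : lieAlgType K) n (x y : V) : lcs n y -> lcs n.+1 [< x, y >].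
Proof.
move=> ly; rewrite -[[< x, y >]]scale1r -[_ *: _]addr0.
exact/(@lbr_span_lbr _ _ (lcs n))/lbr_span0.
Qed.

(** Linearity restated for Lie morphisms: the general lemmas of linear maps
    leave the map under its coercion to linear maps, where rules stated for Lie
    morphisms no longer rewrite. *)
Section LieMorphismLinear.
Variables (U V : lieAlgType K) (f : {lie U -> V}).

Lemma lie_morph0 : f 0 = 0. Proof. exact: linear0. Qed.

Lemma lie_morphD x y : f (x + y) = f x + f y. Proof. exact: linearD. Qed.

Lemma lie_morphB x y : f (x - y) = f x - f y. Proof. exact: linearB. Qed.

Lemma lie_morphN x : f (- x) = - f x. Proof. exact: linearN. Qed.

Lemma lie_morphZ a x : f (a *: x) = a *: f x. Proof. exact: linearZ. Qed.

Lemma lie_morph_inj : (forall x, f x = 0 -> x = 0) -> injective f.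
Proof. exact: raddf_inj. Qed.

Lemma lie_morph_lcs n x : lcs n x -> lcs n (f x).
Proof.
elim: n x => // n IH x.
apply: (@lbr_span_ind _ (lcs n) (fun x => lcs n.+1 (f x))) => [|a y z|y s].
- by rewrite lie_morph0; apply: lcs0.
- by rewrite lie_morphD lie_morphZ; apply: lcs_linear.
- by rewrite lie_morphE => /IH; apply: lcs_br.
Qed.

End LieMorphismLinear.

Lemma lcs_succ (V : lieAlgType K) n (x : V) : lcs n.+1 x -> lcs n x.
Proof.
elim: n x => // n IH x; apply: lbr_span_ind; first exact: lbr_span0.
  exact: lbr_span_linear.
by move=> y s /IH; apply: lcs_br.
Qed.

Lemma nilpotent_le_leq (V : lieAlgType K) d c :
  (d <= c)%N -> nilpotent_le V d -> nilpotent_le V c.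
Proof.
move=> /subnKC <-; elim: (c - d)%N => [|n IH]; rewrite ?addn0 ?addnS //.
by move=> nd x /lcs_succ; apply: IH.
Qed.

End LieComplements.

(** * Free nilpotent algebras of class 2 *)

Section FreeNil2.
Variable K : fieldType.

(** If the triple brackets of a family vanish, then the subalgebra that it
    generates has class at most 2: what commutes with the generators commutes
    with everything, so each [[f a, phi p]] is central by induction on [p], and
    then each [[phi p, phi q]] is central by induction on [p]. *)
Section Lift.
Variables (X : Type) (W : lieAlgType K) (f : X -> W).
Hypothesis f_nil2 : forall a b c, [< f a, [< f b, f c >] >] = 0.
Local Notation phi := (free_lift f).

Let central (z : W) := forall p, [< phi p, z >] = 0.

Let central0 : central 0. Proof. by move=> p; rewrite lbr0r. Qed.

Let centralP (a : K) z w : central z -> central w -> central (a *: z + w).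
Proof. by move=> cz cw p; rewrite lbr_linearr cz cw scaler0 addr0. Qed.

Let central_gen z : (forall a, [< f a, z >] = 0) -> central z.
Proof.
move=> fz; elim/freeLie_ind => [a||a p q pz qz|p q pz qz].
- by rewrite free_liftE.
- by rewrite linear0 lbr0l.
- by rewrite linearP /= lbr_linearl pz qz scaler0 addr0.
rewrite lie_morphE; have := lbrA (phi p) (phi q) z.
by rewrite pz qz !lbr0r addr0.
Qed.

Let central_lbr_gen a p : central [< f a, phi p >].
Proof.
elim/freeLie_ind: p => [b||k p q cp cq|p q cp cq].
- by rewrite free_liftE; apply: central_gen.
- by rewrite linear0 lbr0r.
- by rewrite linearP /= lbr_linearr; apply: centralP.
rewrite lie_morphE lbrA cq addr0 lbrC cp oppr0.
exact: central0.
Qed.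

Lemma free_lift_central p q : central [< phi p, phi q >].
Proof.
elim/freeLie_ind: p q => [a||k p p' cp cp'|p p' cp cp'] q.
- by rewrite free_liftE; apply: central_lbr_gen.
- by rewrite linear0 lbr0l; apply: central0.
- by rewrite linearP /= lbr_linearl; apply: centralP; [apply: cp | apply: cp'].
by rewrite lie_morphE lbrC cp oppr0; apply: central0.
Qed.

Lemma free_lift_lcs2 p : lcs_ideal (freeLie K X) 2 p -> phi p = 0.
Proof.
apply: (@lbr_span_ind _ _ (lcs 1) (fun p => phi p = 0)).
- exact: linear0.
- move=> a x y px py.
  by rewrite linearP /= px py scaler0 addr0.
move=> x s ls; suff cs : central (phi s) by rewrite lie_morphE.
apply: (@lbr_span_ind _ _ (lcs 0) (fun s => central (phi s))) ls.
- by rewrite linear0; apply: central0.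
- by move=> a y z; rewrite linearP /=; apply: centralP.
- by move=> y z _; rewrite lie_morphE; apply: free_lift_central.
Qed.

End Lift.

Definition nil_gen r (i : 'I_r) : freeNil K r 2 := quot_pi _ (free_var K i).

Section NilLift.
Variables (r : nat) (W : lieAlgType K) (f : 'I_r -> W).
Hypothesis f_nil2 : forall a b c, [< f a, [< f b, f c >] >] = 0.

Definition nil_lift : {lie freeNil K r 2 -> W} :=
  quot_lift (free_lift_lcs2 f_nil2).

Lemma nil_liftE i : nil_lift (nil_gen i) = f i.
Proof. by rewrite /nil_lift quot_liftE free_liftE. Qed.

End NilLift.

Lemma freeNil_ind r (P : freeNil K r 2 -> Prop) :
    (forall i, P (nil_gen i)) -> P 0 ->
    (forall a p q, P p -> P q -> P (a *: p + q)) ->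
    (forall p q, P p -> P q -> P [< p, q >]) ->
  forall p, P p.
Proof.
move=> Pg P0 Pl Pb p; have [t ->] := quot_pi_surj p.
elim/freeLie_ind: t => [i||a t u Pt Pu|t u Pt Pu]; first exact: Pg.
- by rewrite linear0.
- by rewrite linearP; apply: Pl.
- by rewrite lie_morphE; apply: Pb.
Qed.

Lemma freeNil_nil2 r : nil2 (freeNil K r 2).
Proof.
move=> p q s.
have [[x ->] [[y ->] [z ->]]] :=
  (quot_pi_surj p, (quot_pi_surj q, quot_pi_surj s)).
rewrite -!lie_morphE -(linear0 (quot_pi (lcs_ideal (freeLie K 'I_r) 2))).
by apply/quot_piE; rewrite subr0; do 2!apply: lcs_br.
Qed.

Definition ltpair r := {s : 'I_r * 'I_r | (s.1 < s.2)%N}.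

Lemma card_ltpair r : #|{: ltpair r}| = 'C(r, 2).
Proof.
rewrite card_sig -sum1_card -bin2_sum big_mkord.
rewrite -(pair_big_dep xpredT (fun i j : 'I_r => (i < j)%N)
  (fun _ _ => 1%N)) /=.
rewrite (exchange_big_dep xpredT) //=; apply: eq_bigr => j _.
by rewrite (big_ord_narrow (ltnW (ltn_ord j))) sum1_card card_ord.
Qed.

(** A free nilpotent algebra of class 2 has the generators and the brackets of
    two generators, in increasing order, as a basis.  Combinations of these
    are formed for a family [f] in an arbitrary Lie algebra, so that they can be
    carried along morphisms: linear independence is obtained in a model. *)
Section Coordinates.
Variables (r : nat).
Definition nil_coord := ('rV[K]_r * {ffun ltpair r -> K^o})%type.

Definition nil_comb (W : lieAlgType K) (f : 'I_r -> W) (ua : nil_coord) : W :=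
  \sum_i ua.1 0 i *: f i
  + \sum_s (ua.2 s : K) *: [< f (val s).1, f (val s).2 >].

Lemma nil_comb_linear W f : linear (@nil_comb W f).
Proof.
move=> a x y; rewrite /nil_comb scalerDr addrACA; congr (_ + _).
  rewrite scaler_sumr -big_split; apply: eq_bigr => i _ /=.
  by rewrite !mxE scalerDl scalerA.
rewrite scaler_sumr -big_split; apply: eq_bigr => i _ /=.
by rewrite !ffunE scalerDl scalerA.
Qed.

HB.instance Definition _ (W : lieAlgType K) f :=
  GRing.isLinear.Build K nil_coord W *:%R (@nil_comb W f) (nil_comb_linear f).

Lemma nil_comb_morph (V W : lieAlgType K) (h : {lie V -> W}) f ua :
  h (nil_comb f ua) = nil_comb (h \o f) ua.
Proof.
rewrite /nil_comb linearD !linear_sum /=.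
congr (_ + _); apply: eq_bigr => i _; rewrite linearZ_LR //=.
by rewrite lie_morphE.
Qed.

Definition gen_coord (i : 'I_r) : nil_coord := (delta_mx 0 i, 0).
Definition br_coord (s : ltpair r) : nil_coord :=
  (0, [ffun t => (t == s)%:R]).

Lemma nil_comb_gen (W : lieAlgType K) (f : 'I_r -> W) i :
  nil_comb f (gen_coord i) = f i.
Proof.
rewrite /nil_comb /= [X in _ + X]big1 ?addr0 => [|s _].
  rewrite (bigD1 i) //= big1 ?addr0 => [|j /negPf ji].
    by rewrite mxE !eqxx scale1r.
  by rewrite mxE eqxx ji scale0r.
by rewrite ffunE scale0r.
Qed.

Lemma nil_comb_br (W : lieAlgType K) (f : 'I_r -> W) s :
  nil_comb f (br_coord s) = [< f (val s).1, f (val s).2 >].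
Proof.
rewrite /nil_comb /= big1 ?add0r => [|i _]; last by rewrite mxE scale0r.
rewrite (bigD1 s) //= big1 ?addr0 => [|t /negPf ts].
  by rewrite ffunE eqxx scale1r.
by rewrite ffunE ts scale0r.
Qed.

(** Since brackets of two elements are central, the bracket of two combinations
    only involves brackets of generators. *)
Lemma nil_comb_surj (p : freeNil K r 2) :
  exists ua, p = nil_comb (@nil_gen r) ua.
Proof.
pose P (p : freeNil K r 2) := exists ua, p = nil_comb (@nil_gen r) ua.
have P0 : P 0 by exists 0; rewrite linear0.
have Pl a q s : P q -> P s -> P (a *: q + s).
  by move=> [x ->] [y ->]; exists (a *: x + y); rewrite linearP.
have PZ a q : P q -> P (a *: q).
  by move=> Pq; rewrite -[_ *: _]addr0; apply: Pl.
have PD q s : P q -> P s -> P (q + s) by rewrite -{2}[q]scale1r; apply: Pl.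
have Pgen i : P (nil_gen i).
  by exists (gen_coord i); rewrite nil_comb_gen.
have Plt (i j : 'I_r) : (i < j)%N -> P [< nil_gen i, nil_gen j >].
  by move=> ij; exists (br_coord (exist _ (i, j) ij)); rewrite nil_comb_br.
have Pij i j : P [< nil_gen i, nil_gen j >].
  case: (ltngtP i j) => [|ji|/val_inj->]; first exact: Plt.
    by rewrite lbrC -scaleN1r; apply/PZ/Plt.
  by rewrite lbrxx.
rewrite -/(P p); elim/freeNil_ind: p => //.
move=> _ _ [x ->] [y ->]; rewrite /nil_comb.
have central (s : freeNil K r 2) (a : ltpair r -> K) :
  [< s, \sum_t a t *: [< nil_gen (val t).1, nil_gen (val t).2 >] >] = 0.
  by rewrite lbr_sumr big1 // => t _; rewrite lbrZr freeNil_nil2 scaler0.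
rewrite lbrDr central addr0 lbrC lbrDr central addr0 -lbrC lbr_suml.
apply: (big_ind P) => // i _; rewrite lbr_sumr; apply: (big_ind P) => // j _.
by rewrite lbrZl lbrZr; apply/PZ/PZ/Pij.
Qed.

End Coordinates.
End FreeNil2.

(** * Alternating tensors *)

(** A matrix [A] stands for the tensor [\sum_(i, j) A i j *: e_i (x) e_j], so
    that [u^T *m v] is [u (x) v].  Both operations are locked to keep the rules
    of matrix algebra from rewriting inside them. *)
Section Wedge.
Variables (K : fieldType) (k : nat).
Implicit Types (u v w : 'rV[K]_k) (P Q A B : 'M[K]_k) (a : K).

Fact wedge_key : unit. Proof. exact: tt. Qed.
Definition wedge : 'rV[K]_k -> 'rV[K]_k -> 'M[K]_k :=
  locked_with wedge_key (fun u v => u^T *m v - v^T *m u).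

Lemma wedge_mxE u v : wedge u v = u^T *m v - v^T *m u.
Proof. by rewrite /wedge unlock. Qed.

Lemma wedgexx u : wedge u u = 0.
Proof. by rewrite wedge_mxE subrr. Qed.

Lemma wedgeC u v : wedge u v = - wedge v u.
Proof. by rewrite !wedge_mxE opprB. Qed.

Lemma wedgePl a u v w : wedge (a *: u + v) w = a *: wedge u w + wedge v w.
Proof.
rewrite !wedge_mxE linearP /= mulmxDl mulmxDr -scalemxAl -scalemxAr scalerBr.
by rewrite opprD addrACA.
Qed.

Lemma wedge0l u : wedge 0 u = 0.
Proof. by rewrite !wedge_mxE trmx0 mul0mx mulmx0 subrr. Qed.

Lemma wedgeZl a u v : wedge (a *: u) v = a *: wedge u v.
Proof. by rewrite -[a *: u]addr0 wedgePl wedge0l addr0. Qed.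

Lemma wedgeDl u v w : wedge (u + v) w = wedge u w + wedge v w.
Proof. by rewrite -[u]scale1r wedgePl !scale1r. Qed.

Lemma wedge0r u : wedge u 0 = 0.
Proof. by rewrite wedgeC wedge0l oppr0. Qed.

Lemma wedgeZr a u v : wedge v (a *: u) = a *: wedge v u.
Proof. by rewrite wedgeC wedgeZl -scalerN -wedgeC. Qed.

Lemma wedgeDr u v w : wedge w (u + v) = wedge w u + wedge w v.
Proof. by rewrite wedgeC wedgeDl opprD -!wedgeC. Qed.

Lemma wedgeE u v i j : wedge u v i j = u 0 i * v 0 j - v 0 i * u 0 j.
Proof. by rewrite wedge_mxE !mxE !big_ord1 !mxE. Qed.

(** The derivation of the tensor square induced by the endomorphism
    [u |-> u *m P]. *)
Fact mx_act_key : unit. Proof. exact: tt. Qed.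
Definition mx_act : 'M[K]_k -> 'M[K]_k -> 'M[K]_k :=
  locked_with mx_act_key (fun P A => P^T *m A + A *m P).

Lemma mx_actE P A : mx_act P A = P^T *m A + A *m P.
Proof. by rewrite /mx_act unlock. Qed.

Lemma mx_actPl a P Q A : mx_act (a *: P + Q) A = a *: mx_act P A + mx_act Q A.
Proof.
rewrite !mx_actE linearP /= mulmxDl mulmxDr -scalemxAl -scalemxAr scalerDr.
by rewrite addrACA.
Qed.

Lemma mx_actPr a P A B : mx_act P (a *: A + B) = a *: mx_act P A + mx_act P B.
Proof.
by rewrite !mx_actE mulmxDl mulmxDr -scalemxAl -scalemxAr scalerDr addrACA.
Qed.

Lemma mx_act0l A : mx_act 0 A = 0.
Proof. by rewrite !mx_actE trmx0 mul0mx mulmx0 addr0. Qed.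

Lemma mx_act0r P : mx_act P 0 = 0.
Proof. by rewrite !mx_actE mul0mx mulmx0 addr0. Qed.

Lemma mx_actZr a P A : mx_act P (a *: A) = a *: mx_act P A.
Proof. by rewrite -[a *: A]addr0 mx_actPr mx_act0r addr0. Qed.

Lemma mx_actDr P A B : mx_act P (A + B) = mx_act P A + mx_act P B.
Proof. by rewrite -[A]scale1r mx_actPr !scale1r. Qed.

Lemma mx_actNr P A : mx_act P (- A) = - mx_act P A.
Proof. by rewrite -scaleN1r mx_actZr scaleN1r. Qed.

Lemma mx_act_wedge P u v :
  mx_act P (wedge u v) = wedge (u *m P) v + wedge u (v *m P).
Proof.
rewrite mx_actE !wedge_mxE !trmx_mul mulmxBl mulmxBr !mulmxA addrACA.
by rewrite -opprD [X in _ - X]addrC opprD addrACA.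
Qed.

Lemma mx_act_mx_act P Q A : Q *m P = 0 -> P *m Q = 0 ->
  mx_act P (mx_act Q A) = P^T *m A *m Q + Q^T *m A *m P.
Proof.
move=> QP PQ; rewrite !mx_actE mulmxDl mulmxDr !mulmxA -trmx_mul QP trmx0.
by rewrite mul0mx add0r -[X in _ + (_ + X)]mulmxA QP mulmx0 addr0.
Qed.

End Wedge.

(** * The tensor model *)

(** In this section [c x] is the row vector of the coordinates of [x] in the
    basis [b], and [ad_mx x] is the matrix of [lbr x]. *)
Section Model.
Variables (K : fieldType) (g : lieAlgType K) (k : nat).
Variables (b : 'I_k -> g) (c : {linear g -> 'rV[K]_k}).
Hypothesis bc : forall x, x = \sum_i c x 0 i *: b i.
Hypothesis g_nil2 : nil2 g.
Hypothesis two_neq0 : 2 != 0 :> K.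

Local Notation half := (2^-1 : K).
Implicit Types x y z : g.

Definition ad_mx x : 'M[K]_k := \matrix_i c [< x, b i >].

Lemma mul_ad_mx x y : c y *m ad_mx x = c [< x, y >].
Proof.
rewrite mulmx_sum_row {2}[y]bc lbr_sumr linear_sum; apply: eq_bigr => i _ /=.
by rewrite rowK lbrZr linearZ.
Qed.

Lemma ad_mx_linear : linear ad_mx.
Proof.
move=> a x y; apply/row_matrixP => i.
by rewrite rowK lbr_linearl [RHS]linearP /= !rowK linearP.
Qed.

HB.instance Definition _ := GRing.isLinear.Build K g _ *:%R ad_mx ad_mx_linear.

Lemma ad_mx_lbr x y : ad_mx [< x, y >] = 0.
Proof.
by apply/row_matrixP=> i; rewrite rowK row0 lbrC g_nil2 oppr0 linear0.
Qed.

Lemma ad_mx_mul x y : ad_mx x *m ad_mx y = 0.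
Proof.
by apply/row_matrixP=> i; rewrite row_mul rowK mul_ad_mx g_nil2 linear0 row0.
Qed.

Definition gwedge x y := wedge (c x) (c y).
Definition ad_act x A := mx_act (ad_mx x) A.

Lemma gwedgeC x y : gwedge x y = - gwedge y x. Proof. exact: wedgeC. Qed.

Lemma gwedgeD x y z : gwedge x (y + z) = gwedge x y + gwedge x z.
Proof. by rewrite /gwedge linearD wedgeDr. Qed.

Lemma gwedgeZ a x y : gwedge x (a *: y) = a *: gwedge x y.
Proof. by rewrite /gwedge linearZ wedgeZr. Qed.

Lemma gwedgeN x y : gwedge x (- y) = - gwedge x y.
Proof. by rewrite -scaleN1r gwedgeZ scaleN1r. Qed.

Lemma ad_actD x A B : ad_act x (A + B) = ad_act x A + ad_act x B.
Proof. exact: mx_actDr. Qed.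

Lemma ad_actZ a x A : ad_act x (a *: A) = a *: ad_act x A.
Proof. exact: mx_actZr. Qed.

Lemma ad_actN x A : ad_act x (- A) = - ad_act x A.
Proof. exact: mx_actNr. Qed.

Lemma ad_act_lbr x y A : ad_act [< x, y >] A = 0.
Proof. by rewrite /ad_act ad_mx_lbr mx_act0l. Qed.

Lemma ad_act_wedge x y z :
  ad_act x (gwedge y z) = gwedge [< x, y >] z + gwedge y [< x, z >].
Proof. by rewrite /ad_act mx_act_wedge !mul_ad_mx. Qed.

(** In class 2 the product of two adjoint maps vanishes, so in [ad_act x] after
    [ad_act y] only the two terms survive in which [x] and [y] act on different
    tensor factors. *)
Lemma ad_actC x y A : ad_act x (ad_act y A) = ad_act y (ad_act x A).
Proof. by rewrite /ad_act !mx_act_mx_act ?ad_mx_mul // addrC. Qed.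

(** Of three adjoint maps, two act on the same tensor factor. *)
Lemma ad_act3 x y z A : ad_act x (ad_act y (ad_act z A)) = 0.
Proof.
rewrite [ad_act y _]mx_act_mx_act ?ad_mx_mul // /ad_act mx_actE.
rewrite mulmxDl mulmxDr !mulmxA.
rewrite -!trmx_mul !ad_mx_mul !trmx0 !mul0mx -!mulmxA !ad_mx_mul !mulmx0.
by rewrite !addr0.
Qed.

Definition model_carrier : lmodType K := (g * g * 'M[K]_k)%type.
Implicit Types X Y Z : model_carrier.

(** The triple [(x, u, A)] stands for [chi_p x + chi_q u + A] (see below), where
    the tensor [A] replaces a combination of brackets of two [chi_q]; the
    formula comes from the rules [chi_pp], [chi_pq] and [chi_qp].  The last two
    make [x] act on tensors through half of its adjoint map. *)
Definition model_lbr X Y : model_carrier :=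
  let: (p, u, A) := X in let: (q, v, B) := Y in
  ([< p, q >], half *: ([< p, v >] + [< u, q >]),
   gwedge u v - gwedge p q + half *: (ad_act p B - ad_act q A)).

Lemma model_lbrxx X : model_lbr X X = 0.
Proof.
case: X => [[p u] A]; rewrite /model_lbr lbrxx [ [< u, p >] ]lbrC subrr.
by rewrite scaler0 /gwedge !wedgexx !subr0 subrr scaler0 addr0.
Qed.

Lemma model_lbr_linearl a X Y Z :
  model_lbr (a *: X + Y) Z = a *: model_lbr X Z + model_lbr Y Z.
Proof.
case: X Y Z => [[p u] A] [[q v] B] [[r s] C]; congr (_, _, _) => /=.
- exact: lbr_linearl.
- rewrite !lbr_linearl scalerA mulrC -scalerA -scalerDr; congr (_ *: _).
  by rewrite scalerDr addrACA.
rewrite /gwedge /ad_act !linearP !wedgePl mx_actPl mx_actPr /=.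
move: (wedge _ _) (wedge _ _) (wedge _ _) (wedge _ _) => W1 W2 W3 W4.
move: (mx_act _ _) (mx_act _ _) (mx_act _ _) (mx_act _ _) => T1 T2 T3 T4.
by apply/matrixP=> i j; rewrite !mxE; ring.
Qed.

Lemma model_lbrC X Y : model_lbr X Y = - model_lbr Y X.
Proof.
case: X Y => [[p u] A] [[q v] B]; congr (_, _, _) => /=.
- exact: lbrC.
- by rewrite -scalerN opprD addrC -!lbrC.
rewrite [gwedge v u]gwedgeC [gwedge q p]gwedgeC.
move: (gwedge _ _) (gwedge _ _) (ad_act _ _) (ad_act _ _) => W1 W2 A1 A2.
by apply/matrixP=> i j; rewrite !mxE; ring.
Qed.

Lemma model_lbr_linearr a X Y Z :
  model_lbr Z (a *: X + Y) = a *: model_lbr Z X + model_lbr Z Y.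
Proof. by rewrite model_lbrC model_lbr_linearl opprD -scalerN -!model_lbrC. Qed.

(** All wedges are brought to the form [x ^ [y, z]], so that a cyclic
    permutation of [X], [Y] and [Z] permutes the terms up to sign. *)
Lemma model_lbr2 X Y Z : model_lbr X (model_lbr Y Z) =
  let: (p, u, A) := X in let: (q, v, B) := Y in let: (r, s, C) := Z in
  (0, 0, half *: (gwedge u [< q, s >] - gwedge u [< r, v >]
                  - gwedge s [< p, v >] + gwedge v [< p, s >]
                  + gwedge r [< p, q >] - gwedge q [< p, r >])
         - gwedge p [< q, r >]
         + (half * half) *: (ad_act p (ad_act q C) - ad_act p (ad_act r B))).
Proof.
case: X Y Z => [[p u] A] [[q v] B] [[r s] C]; congr (_, _, _) => /=.
- exact: g_nil2.
- by rewrite lbrZr lbrDr !g_nil2 !(addr0, scaler0).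
rewrite gwedgeZ gwedgeD ad_act_lbr subr0 !(ad_actD, ad_actN, ad_actZ).
rewrite !ad_act_wedge [ [< v, r >] ]lbrC gwedgeN.
rewrite [gwedge [< p, v >] _]gwedgeC [gwedge [< p, q >] _]gwedgeC.
move: (ad_act _ _) (ad_act _ _) => A1 A2.
do !(move: (gwedge _ _) => ?).
by apply/matrixP=> i j; rewrite !mxE; ring.
Qed.

Lemma model_jacobi X Y Z :
  model_lbr X (model_lbr Y Z) + model_lbr Y (model_lbr Z X)
  + model_lbr Z (model_lbr X Y) = 0.
Proof.
rewrite !model_lbr2.
case: X Y Z => [[p u] A] [[q v] B] [[r s] C]; congr (_, _, _) => /=.
- by rewrite !addr0.
- by rewrite !addr0.
have wl x y z : gwedge x [< y, z >] = - gwedge x [< z, y >].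
  by rewrite -gwedgeN -lbrC.
rewrite [ad_act q (ad_act p _)]ad_actC [ad_act r (ad_act p _)]ad_actC.
rewrite [ad_act r (ad_act q _)]ad_actC.
rewrite [gwedge q [< p, _ >]]wl [gwedge r [< q, _ >]]wl.
rewrite [gwedge p [< r, _ >]]wl.
move: (ad_act _ _) (ad_act _ _) (ad_act _ _) => A1 A2 A3.
do !(move: (gwedge _ _) => ?).
apply/matrixP=> i j; rewrite !mxE.
by field.
Qed.

Definition chi_model : lieAlgType K :=
  HB.pack_for (lieAlgType K) model_carrier
    (Lmodule_isLieAlgebra.Build K model_carrier model_lbr_linearl
       model_lbr_linearr model_lbrxx model_jacobi).

Lemma chi_model_lbrE (X Y : chi_model) : [< X, Y >] = model_lbr X Y.
Proof. by []. Qed.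

(** The elements of the model that correspond to [chi_p x - chi_q x] and to
    [chi_p x + chi_q x], which are the two copies of [x]. *)
Definition model_id (x : g) : chi_model := (x, - x, 0).
Definition model_psi (x : g) : chi_model := (x, x, 0).

Fact model_id_linear : linear model_id.
Proof.
move=> a x y; congr (_, _, _); first by rewrite /= opprD -scalerN.
by rewrite /= scaler0 addr0.
Qed.

Fact model_psi_linear : linear model_psi.
Proof. by move=> a x y; congr (_, _, _); rewrite /= scaler0 addr0. Qed.

Fact model_id_lbr : {morph model_id : x y / [< x, y >]}.
Proof.
move=> x y; rewrite chi_model_lbrE; congr (_, _, _).
  by rewrite lbrNl lbrNr scale_half.
rewrite gwedgeN [gwedge (- x) y]gwedgeC gwedgeN !opprK -[- gwedge y x]gwedgeC.
by rewrite subrr add0r /ad_act !mx_act0r subr0 scaler0.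
Qed.

Fact model_psi_lbr : {morph model_psi : x y / [< x, y >]}.
Proof.
move=> x y; rewrite chi_model_lbrE; congr (_, _, _).
  by rewrite scale_half.
by rewrite subrr add0r /ad_act !mx_act0r subr0 scaler0.
Qed.

HB.instance Definition _ := GRing.isLinear.Build K g chi_model *:%R model_id
  model_id_linear.
HB.instance Definition _ := isLieMorphism.Build K g chi_model model_id
  model_id_lbr.
HB.instance Definition _ := GRing.isLinear.Build K g chi_model *:%R model_psi
  model_psi_linear.
HB.instance Definition _ := isLieMorphism.Build K g chi_model model_psi
  model_psi_lbr.

Definition fprod_to_model : {lie freeProd g g -> chi_model} :=
  fprod_lift model_id model_psi.

Fact fprod_to_model_rel p :
  ideal_gen (@chi_rel K g) p -> fprod_to_model p = 0.
Proof.
move=> /(_ (lieKer_ideal fprod_to_model)); apply=> _ [x].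
apply: etrans (lie_morphE _ _ _) _; rewrite fprod_liftl fprod_liftr.
rewrite chi_model_lbrE; congr (_, _, _); first exact: lbrxx.
  by rewrite lbrNl lbrxx oppr0 addr0 scaler0.
rewrite [gwedge (- x) x]gwedgeC gwedgeN /gwedge wedgexx !oppr0 add0r.
by rewrite /ad_act !mx_act0r !subr0 scaler0 addr0.
Qed.

Definition chi_to_model : {lie chi g -> chi_model} :=
  quot_lift fprod_to_model_rel.

Lemma chi_to_model_id x : chi_to_model (chi_id x) = (x, - x, 0).
Proof. by rewrite /chi_to_model quot_liftE fprod_liftl. Qed.

Lemma chi_to_model_psi x : chi_to_model (chi_psi x) = (x, x, 0).
Proof. by rewrite /chi_to_model quot_liftE fprod_liftr. Qed.

(** Let [Z] be the center of [g].  From the second on, the terms of the lower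
    central series lie in [Z + Z + V (x) V], in the tensors killed by two adjoint
    actions, in those killed by one, and in 0. *)
Lemma chi_model_nilpotent : nilpotent_le chi_model 4.
Proof.
pose F2 (X : chi_model) := (forall z, [< z, X.1.1 >] = 0) /\
                           (forall z, [< z, X.1.2 >] = 0).
pose F3 (X : chi_model) := [/\ X.1.1 = 0, X.1.2 = 0
  & forall y z, ad_act y (ad_act z X.2) = 0].
pose F4 (X : chi_model) := [/\ X.1.1 = 0, X.1.2 = 0
  & forall z, ad_act z X.2 = 0].
have S2 (X : chi_model) : lcs 1 X -> F2 X.
  apply: (@lbr_span_ind _ _ (lcs 0)) => [|a {}X Y [X1 X2] [Y1 Y2]|Y Z _].
  - by split=> z /=; apply: lbr0r.
  - by split=> z /=; rewrite lbr_linearr ?(X1, X2, Y1, Y2) scaler0 addr0.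
  case: Y Z => [[p u] A] [[q v] B]; split=> z /=; first exact: g_nil2.
  by rewrite lbrZr lbrDr !g_nil2 addr0 scaler0.
have S3 (X : chi_model) : lcs 2 X -> F3 X.
  apply: (@lbr_span_ind _ _ (lcs 1)) => [|a {}X Y [X1 X2 X3] [Y1 Y2 Y3]|Y Z].
  - by split=> //= y z; rewrite /ad_act !mx_act0r.
  - split=> /=; rewrite ?X1 ?X2 ?Y1 ?Y2 ?scaler0 ?addr0 // => y z.
    by rewrite !ad_actD !ad_actZ X3 Y3 scaler0 addr0.
  move=> /S2; case: Y Z => [[p u] A] [[q v] B] [/= Z1 Z2]; split=> //=.
    by rewrite Z1 Z2 addr0 scaler0.
  move=> y z; rewrite !(ad_actD, ad_actN, ad_actZ) !ad_act3 subr0 scaler0 addr0.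
  rewrite !ad_act_wedge !Z1 !Z2 !ad_actD !ad_act_wedge !Z1 !Z2 /gwedge.
  by rewrite !linear0 !wedge0r !g_nil2 !linear0 !wedge0l !addr0 subr0.
have S4 (X : chi_model) : lcs 3 X -> F4 X.
  apply: (@lbr_span_ind _ _ (lcs 2)) => [|a {}X Y [X1 X2 X3] [Y1 Y2 Y3]|Y Z].
  - by split=> //= z; rewrite /ad_act !mx_act0r.
  - split=> /=; rewrite ?X1 ?X2 ?Y1 ?Y2 ?scaler0 ?addr0 // => z.
    by rewrite !ad_actD !ad_actZ X3 Y3 scaler0 addr0.
  move=> /S3; case: Y Z => [[p u] A] [[q v] B] [/= -> -> Z3].
  split=> /= [||z]; first exact: lbr0r.
    by rewrite !lbr0r addr0 scaler0.
  rewrite /gwedge linear0 !wedge0r subr0 add0r ad_actZ ad_actD ad_actN Z3.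
  by rewrite /ad_act linear0 mx_act0l mx_act0r subr0 scaler0.
move=> X.
apply: (@lbr_span_ind _ _ (lcs 3) (fun X : chi_model => X = 0)) => //.
  by move=> a Y Z -> ->; rewrite scaler0 addr0.
move=> Y Z /S4; rewrite chi_model_lbrE.
case: Y Z => [[p u] A] [[q v] B] [/= -> -> Z3].
congr (_, _, _); first exact: lbr0r.
  by rewrite !lbr0r addr0 scaler0.
rewrite /gwedge [c 0]linear0 !wedge0r Z3 /ad_act [ad_mx 0]linear0 mx_act0l.
by rewrite !subr0 add0r scaler0.
Qed.

End Model.

(** * Dimensions *)

Lemma inj_surj_bij (T U : Type) (f : T -> U) :
  injective f -> (forall y, exists x, y = f x) -> bijective f.
Proof.
move=> f_inj f_surj; exists (fun y => sval (cid (f_surj y))).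
  by move=> x; apply: f_inj; case: cid.
by move=> y; case: cid.
Qed.

Section Dimension.
Variable K : fieldType.

Lemma has_dim_bij (U V : lmodType K) n (f : {linear U -> V}) :
  bijective f -> has_dim U n -> has_dim V n.
Proof.
move=> [f' fK f'K] [[h hlin hbij]]; constructor.
exists (h \o f'); last by apply: bij_comp hbij (Bijective f'K fK).
have f'lin : linear f'.
  by move=> a x y; apply: (can_inj fK); rewrite linearP /= !f'K.
by move=> a x y; rewrite /= f'lin hlin.
Qed.

Lemma has_dim_prod (U V : lmodType K) m n :
  has_dim U m -> has_dim V n -> has_dim (U * V)%type (m + n).
Proof.
move=> [[f flin [f' fK f'K]]] [[h hlin [h' hK h'K]]]; constructor.
exists (fun x => row_mx (f x.1) (h x.2)).
  by move=> a x y; rewrite /= flin hlin scale_row_mx add_row_mx.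
exists (fun v => (f' (lsubmx v), h' (rsubmx v))) => [[x y]|v] /=.
  by rewrite row_mxKl row_mxKr fK hK.
by rewrite f'K h'K hsubmxK.
Qed.

Lemma has_dim_rV n : has_dim 'rV[K]_n n.
Proof. by constructor; exists id => //; exists id. Qed.

Lemma has_dim_ffun (I : finType) : has_dim {ffun I -> K^o} #|I|.
Proof.
constructor.
exists (fun f : {ffun I -> K^o} => \row_i (f (enum_val i) : K)).
  by move=> a f h; apply/rowP => i; rewrite !mxE !ffunE.
exists (fun v : 'rV[K]_#|I| => [ffun i => v 0 (enum_rank i) : K^o]) => [f|v].
  by apply/ffunP=> i; rewrite ffunE mxE enum_rankK.
by apply/rowP=> i; rewrite mxE ffunE enum_valK.
Qed.

(** The coordinate functions are gathered into one map to row vectors. *)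
Definition dual_bases (V : lmodType K) k (b : 'I_k -> V) (c : V -> 'rV[K]_k) :=
  (forall x, x = \sum_i c x 0 i *: b i) /\ (forall i, c (b i) = delta_mx 0 i).

Lemma has_dim_basis (V : lmodType K) k : has_dim V k ->
  exists (b : 'I_k -> V) (c : {linear V -> 'rV[K]_k}), dual_bases b c.
Proof.
move=> [[h hlin [h' hK h'K]]].
pose c := HB.pack_for {linear V -> 'rV[K]_k} h
  (GRing.isLinear.Build K V _ *:%R h hlin).
exists (fun i => h' (delta_mx 0 i)), c; split=> [x|i]; last exact: h'K.
apply: (can_inj hK); rewrite -[h]/(c : _ -> _) linear_sum /=.
rewrite {1}[h x]row_sum_delta; apply: eq_bigr => i _.
by rewrite -[h]/(c : _ -> _) linearZ /= h'K.
Qed.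

End Dimension.

(** * The commutation rules of chi *)

Section ChiInd.
Variables (K : fieldType) (g : lieAlgType K).

Fact chi_id_linear : linear (@chi_id K g).
Proof. by move=> a x y; rewrite /chi_id !linearP. Qed.
Fact chi_id_lbr : {morph (@chi_id K g) : x y / [< x, y >]}.
Proof. by move=> x y; rewrite /chi_id !lie_morphE. Qed.
Fact chi_psi_linear : linear (@chi_psi K g).
Proof. by move=> a x y; rewrite /chi_psi !linearP. Qed.
Fact chi_psi_lbr : {morph (@chi_psi K g) : x y / [< x, y >]}.
Proof. by move=> x y; rewrite /chi_psi !lie_morphE. Qed.

HB.instance Definition _ := GRing.isLinear.Build K g (chi g) *:%R (@chi_id K g)
  chi_id_linear.
HB.instance Definition _ := isLieMorphism.Build K g (chi g) (@chi_id K g)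
  chi_id_lbr.
HB.instance Definition _ := GRing.isLinear.Build K g (chi g) *:%R (@chi_psi K g)
  chi_psi_linear.
HB.instance Definition _ := isLieMorphism.Build K g (chi g) (@chi_psi K g)
  chi_psi_lbr.

Lemma chi_ind (P : chi g -> Prop) :
    (forall x, P (chi_id x)) -> (forall x, P (chi_psi x)) ->
    (forall a u v, P u -> P v -> P (a *: u + v)) ->
    (forall u v, P u -> P v -> P [< u, v >]) ->
  forall u, P u.
Proof.
move=> Pi Pj Pl Pb u; have [v ->] := quot_pi_surj u.
have [t ->] := quot_pi_surj v.
elim/freeLie_ind: t => [[x|x]||a t t' Pt Pt'|t t' Pt Pt'].
- exact: Pi.
- exact: Pj.
- by rewrite !linear0 -(linear0 (@chi_id K g)); apply: Pi.
- by rewrite !linearP; apply: Pl.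
- by rewrite !lie_morphE; apply: Pb.
Qed.

Lemma chi_idpsi x : [< chi_id x, chi_psi x >] = 0 :> chi g.
Proof.
rewrite /chi_id /chi_psi -lie_morphE.
rewrite -(linear0 (quot_pi (ideal_gen (@chi_rel K g)))).
by apply/quot_piE; rewrite subr0; apply: ideal_gen_sub.
Qed.

(** The relation [[i x, j x] = 0], polarized. *)
Lemma chi_swap x y :
  [< chi_psi x, chi_id y >] = [< chi_id x, chi_psi y >] :> chi g.
Proof.
have := chi_idpsi (x + y).
rewrite !linearD /= !lbrDl !chi_idpsi add0r addr0 addrC.
by move=> /eqP; rewrite addr_eq0 => /eqP ->; rewrite -lbrC.
Qed.

Hypothesis two_neq0 : 2 != 0 :> K.
Local Notation half := (2^-1 : K).

(** The symmetric and antisymmetric parts of the two embeddings of [g]; the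
    swap of [g] and its copy grades the algebra by parity in [q]. *)
Definition chi_p x : chi g := half *: (chi_psi x + chi_id x).
Definition chi_q x : chi g := half *: (chi_psi x - chi_id x).

Fact chi_p_linear : linear chi_p.
Proof.
move=> a x y; rewrite /chi_p !linearP addrACA -scalerDr [LHS]scalerDr !scalerA.
by rewrite mulrC.
Qed.
Fact chi_q_linear : linear chi_q.
Proof.
move=> a x y; rewrite /chi_q !linearP addrACA -scalerDr [LHS]scalerDr !scalerA.
by rewrite mulrC.
Qed.
HB.instance Definition _ := GRing.isLinear.Build K g (chi g) *:%R chi_p
  chi_p_linear.
HB.instance Definition _ := GRing.isLinear.Build K g (chi g) *:%R chi_q
  chi_q_linear.

Lemma chi_idE x : chi_id x = chi_p x - chi_q x.
Proof.
by rewrite /chi_p /chi_q -scalerBr opprB addrC addrA subrK scale_half.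
Qed.

Lemma chi_psiE x : chi_psi x = chi_p x + chi_q x.
Proof.
by rewrite /chi_p /chi_q -scalerDr addrACA subrr addr0 scale_half.
Qed.

Lemma chi_pq x y : [< chi_p x, chi_q y >] = half *: chi_q [< x, y >].
Proof.
rewrite /chi_p /chi_q lbrZl lbrZr; congr (_ *: (_ *: _)).
by rewrite lbrDl !lbrBr chi_swap subrKA -!lie_morphE.
Qed.

Lemma chi_q_lbr x y : chi_q [< x, y >] = [< 2 *: chi_p x, chi_q y >].
Proof.
rewrite lbrZl chi_pq; move: (chi_q _) => u.
by rewrite scalerA mulfV // scale1r.
Qed.

Lemma chi_pp x y :
  [< chi_p x, chi_p y >] = chi_p [< x, y >] - [< chi_q x, chi_q y >].
Proof.
apply/eqP; rewrite eq_sym subr_eq; apply/eqP.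
rewrite /chi_p /chi_q !lbrZl !lbrZr -!scalerDr; congr (_ *: _).
rewrite lbrDl lbrBl !lbrDr !lbrNr chi_swap opprB chi_psi_lbr chi_id_lbr.
set A := [< chi_psi x, chi_psi y >]; set D := [< chi_id x, chi_id y >].
set C := [< chi_id x, chi_psi y >].
rewrite addrACA [A + C + _]addrACA subrr addr0 [C + D]addrC [D + C + _]addrACA.
by rewrite subrr addr0 addrACA scale_half.
Qed.

Lemma chi_qp x y : [< chi_q x, chi_p y >] = half *: chi_q [< x, y >].
Proof. by rewrite lbrC chi_pq -scalerN -linearN -lbrC. Qed.

(** Replace [[q y, q z]] by [p [y, z] - [p y, p z]] and let [q x] act on the
    second bracket as a derivation: the coefficient is [1 / 2 - 1 / 4]. *)
Lemma chi_qqq x y z : [< chi_q x, [< chi_q y, chi_q z >] >]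
  = (half * half) *: chi_q [< x, [< y, z >] >].
Proof.
have -> : [< chi_q y, chi_q z >] = chi_p [< y, z >] - [< chi_p y, chi_p z >].
  by rewrite chi_pp opprB addrCA subrr addr0.
rewrite lbrBr chi_qp [in X in _ - X]lbrA chi_qp chi_qp lbrZl lbrZr.
rewrite chi_qp chi_pq.
rewrite -scalerDr -scalerDr -(linearD chi_q) /= -lbrA.
move: (chi_q _) => u; rewrite scalerA -scalerBl; congr (_ *: _).
by field.
Qed.

Lemma alpha_p x : chi_alpha g (chi_p x) = x.
Proof.
by rewrite lie_morphZ lie_morphD chi_alpha_id chi_alpha_psi scale_half.
Qed.

Lemma alpha_q x : chi_alpha g (chi_q x) = 0.
Proof.
by rewrite lie_morphZ lie_morphB chi_alpha_id chi_alpha_psi subrr scaler0.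
Qed.

End ChiInd.

(** * The structure of chi and of the kernel of alpha in class 2 *)

Section Structure.
Variables (K : fieldType) (g : lieAlgType K) (k : nat).
Variables (b : 'I_k -> g) (c : {linear g -> 'rV[K]_k}).
Hypothesis bc : dual_bases b c.
Hypothesis g_nil2 : nil2 g.
Hypothesis two_neq0 : 2 != 0 :> K.
Local Notation half := (2^-1 : K).
Local Notation toM := (chi_to_model bc.1 g_nil2 two_neq0).
Local Notation M := (chi_model bc.1 g_nil2 two_neq0).

Definition model_q (x : g) : M := (0, x, 0).

Lemma model_q_lbr x y : [< model_q x, model_q y >] = (0, 0, gwedge c x y) :> M.
Proof.
rewrite chi_model_lbrE; congr (_, _, _); first exact: lbrxx.
  by rewrite lbr0l lbr0r addr0 scaler0.
rewrite /gwedge [c 0]linear0 wedgexx subr0 /ad_act mx_act0r subr0 scaler0.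
exact: addr0.
Qed.

Lemma model_q_nil2 i j l :
  [< model_q (b i), [< model_q (b j), model_q (b l) >] >] = 0.
Proof.
rewrite model_q_lbr chi_model_lbrE; congr (_, _, _); first exact: lbrxx.
  by rewrite lbr0l lbr0r addr0 scaler0.
rewrite /gwedge [c 0]linear0 !wedge0r subr0 /ad_act [ad_mx _ _ 0]linear0.
by rewrite mx_act0l mx_act0r subr0 scaler0 addr0.
Qed.

Lemma model_comb ua : nil_comb (model_q \o b) ua =
  (0, \sum_i ua.1 0 i *: b i,
   \sum_s (ua.2 s : K) *: gwedge c (b (val s).1) (b (val s).2)) :> M.
Proof.
rewrite /nil_comb.
have -> : \sum_i ua.1 0 i *: (model_q \o b) i
    = (0, \sum_i ua.1 0 i *: b i, 0) :> M.
  apply: (big_ind2 (fun (X : M) (x : g) => X = (0, x, 0))) => //=.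
    by move=> _ x _ y -> ->; congr (_, _, _); exact: addr0.
  by move=> i _; congr (_, _, _); exact: scaler0.
have -> : \sum_s (ua.2 s : K) *:
      [< (model_q \o b) (val s).1, (model_q \o b) (val s).2 >]
    = (0, 0, \sum_s (ua.2 s : K) *: gwedge c (b (val s).1) (b (val s).2)) :> M.
  apply: (big_ind2 (fun (X : M) (x : 'M_k) => X = (0, 0, x))) => //=.
    by move=> _ x _ y -> ->; congr (_, _, _); exact: addr0.
  by move=> s _; rewrite model_q_lbr; congr (_, _, _); exact: scaler0.
by congr (_, _, _); [exact: addr0 | exact: addr0 | exact: add0r].
Qed.

(** The coordinates [u] are read off the second component, and the coefficient
    of the bracket indexed by [(i, j)] is the entry [(i, j)] of the tensor: a
    wedge [e_i' ^ e_j'] with [i' < j'] also has a nonzero entry at [(j', i')],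
    but that entry lies below the diagonal. *)
Lemma model_comb_inj : injective (nil_comb (model_q \o b)).
Proof.
apply: raddf_inj => -[u a]; rewrite /= model_comb => -[u0 a0].
have {u0}-> : u = 0.
  apply/rowP => i; have := congr1 (fun x => c x 0 i) u0.
  rewrite linear_sum /= summxE (bigD1 i) //= big1 => [|j /negPf ji].
    by rewrite linearZ linear0 /= bc.2 !mxE !eqxx mulr1 addr0.
  by rewrite linearZ /= bc.2 !mxE eqxx eq_sym ji mulr0.
congr (_, _); apply/ffunP => s; rewrite [RHS]ffunE.
have := congr1 (fun A : 'M_k => A (val s).1 (val s).2) a0.
have deltaE i j : c (b i) 0 j = (j == i)%:R by rewrite bc.2 mxE eqxx.
rewrite summxE mxE (bigD1 s) //= big1 => [|t ts];
  rewrite mxE /gwedge wedgeE !deltaE.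
  have s12 : ((val s).1 == (val s).2) = false.
    by rewrite -val_eqE /= ltn_eqF ?(valP s).
  by rewrite !eqxx s12 mul0r subr0 !mulr1 addr0.
rewrite -!natrM !mulnb -[_ && _]/(val s == val t) val_eqE.
rewrite eq_sym (negPf ts) (_ : _ && _ = false) ?subrr ?mulr0 //.
apply/negbTE; apply/negP => /andP[/eqP s1 /eqP s2].
by have := valP t; rewrite /= -s1 -s2 ltnNge ltnW ?(valP s).
Qed.

(** Only the dimension of [g] enters the conclusion; an abelian [g] provides
    every value of [k]. *)
Lemma nil_comb_gen_inj : injective (nil_comb (@nil_gen K k)).
Proof.
move=> x y /(congr1 (nil_lift model_q_nil2)); rewrite !nil_comb_morph.
have -> : nil_lift model_q_nil2 \o @nil_gen K k = model_q \o b.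
  by apply/funext => i; apply: nil_liftE.
exact: model_comb_inj.
Qed.

Fact chiL_q_subproof x : chi_alpha g (chi_q x) == 0.
Proof. by apply/eqP/alpha_q. Qed.
Definition chiL_q x : chiL g := LieKer (chiL_q_subproof x).

Lemma chi_q_nil2 i j l :
  [< chi_q (b i), [< chi_q (b j), chi_q (b l) >] >] = 0 :> chi g.
Proof. by rewrite chi_qqq // g_nil2 linear0 scaler0. Qed.

Lemma chiL_q_nil2 i j l :
  [< chiL_q (b i), [< chiL_q (b j), chiL_q (b l) >] >] = 0 :> chiL g.
Proof. by apply: lieKer_inj; apply: chi_q_nil2. Qed.

Definition freeNil_to_chi : {lie freeNil K k 2 -> chi g} := nil_lift chi_q_nil2.
Definition freeNil_to_chiL : {lie freeNil K k 2 -> chiL g} :=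
  nil_lift chiL_q_nil2.

Lemma val_freeNil_to_chiL p : lieKer_val (freeNil_to_chiL p) = freeNil_to_chi p.
Proof.
elim/freeNil_ind: p => [i||a p q Pp Pq|p q Pp Pq].
- by rewrite /freeNil_to_chiL /freeNil_to_chi !nil_liftE.
- by rewrite !lie_morph0.
- by rewrite !lie_morphD !lie_morphZ -Pp -Pq.
- by rewrite !lie_morphE -Pp -Pq.
Qed.

Lemma alpha_freeNil_to_chi p : chi_alpha g (freeNil_to_chi p) = 0.
Proof.
by rewrite -val_freeNil_to_chiL; case: (freeNil_to_chiL p) => u /= /eqP.
Qed.

Lemma chi_to_model_q x : toM (chi_q x) = model_q x.
Proof.
rewrite /chi_q lie_morphZ lie_morphB chi_to_model_id chi_to_model_psi.
congr (_, _, _) => /=; first by rewrite subrr scaler0.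
  by rewrite opprK scale_half.
by rewrite subrr scaler0.
Qed.

Lemma chi_to_model_p x : toM (chi_p x) = (x, 0, 0).
Proof.
rewrite /chi_p lie_morphZ lie_morphD chi_to_model_id chi_to_model_psi.
congr (_, _, _) => /=; first by rewrite scale_half.
  by rewrite subrr scaler0.
by rewrite addr0 scaler0.
Qed.

Lemma chi_to_model_freeNil ua :
  toM (freeNil_to_chi (nil_comb (@nil_gen K k) ua))
  = nil_comb (model_q \o b) ua.
Proof.
rewrite !nil_comb_morph; congr (nil_comb _ ua); apply/funext => i.
by rewrite -[RHS]chi_to_model_q; congr (chi_to_model _ _ _ _); apply: nil_liftE.
Qed.

Lemma freeNil_to_chi_inj : injective freeNil_to_chi.
Proof.
move=> p q.
have [[x ->] [y ->]] := (nil_comb_surj p, nil_comb_surj q).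
move=> /(congr1 toM); rewrite !chi_to_model_freeNil.
by move=> /model_comb_inj ->.
Qed.

Lemma freeNil_to_chi_q x : exists p, chi_q x = freeNil_to_chi p.
Proof.
exists (\sum_i c x 0 i *: nil_gen K i).
rewrite {1}[x]bc.1 !linear_sum; apply: eq_bigr => i _; rewrite !linearZ_LR.
by congr (_ *: _); apply/esym/nil_liftE.
Qed.

(** [lbr (chi_p x)] is a derivation that maps each generator [q b_i] to half of
    [q [x, b_i]], hence it preserves the image. *)
Lemma chi_p_lbr_freeNil x p :
  exists q, [< chi_p x, freeNil_to_chi p >] = freeNil_to_chi q.
Proof.
elim/freeNil_ind: p => [i||a p q [p' Pp] [q' Pq]|p q [p' Pp] [q' Pq]].
- have [p pE] := freeNil_to_chi_q [< x, b i >]; exists (half *: p).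
  by rewrite {1}/freeNil_to_chi nil_liftE chi_pq // pE lie_morphZ.
- by exists 0; rewrite !lie_morph0 lbr0r.
- exists (a *: p' + q').
  by rewrite !lie_morphD !lie_morphZ lbr_linearr Pp Pq.
- exists ([< p', q >] + [< p, q' >]).
  by rewrite lie_morphD !lie_morphE lbrA Pp Pq.
Qed.

(** The right-hand sides form a subalgebra that contains both copies of [g]. *)
Lemma chi_span u : exists x p, u = chi_p x + freeNil_to_chi p.
Proof.
elim/chi_ind: u => [x|x|a _ _ [x [p ->]] [y [q ->]]|_ _ [x [p ->]] [y [q ->]]].
- have [p pE] := freeNil_to_chi_q x; exists x, (- p).
  by rewrite chi_idE // pE -scaleN1r lie_morphZ scaleN1r.
- by have [p pE] := freeNil_to_chi_q x; exists x, p; rewrite chi_psiE // pE.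
- exists (a *: x + y), (a *: p + q).
  rewrite [chi_p (_ + _)]linearP lie_morphD lie_morphZ /=.
  by rewrite scalerDr addrACA.
have [[xq xqE] [yp ypE]] := (chi_p_lbr_freeNil x q, chi_p_lbr_freeNil y p).
have [[qx qxE] [qy qyE]] := (freeNil_to_chi_q x, freeNil_to_chi_q y).
exists [< x, y >], (- [< qx, qy >] + xq + (- yp + [< p, q >])).
rewrite lbrDl !lbrDr chi_pp // [ [< freeNil_to_chi p, chi_p y >] ]lbrC.
by rewrite xqE ypE qxE qyE !lie_morphD !lie_morphN !lie_morphE !addrA.
Qed.

Lemma chiL_iso : lie_isomorphic (chiL g) (freeNil K k 2).
Proof.
apply: lie_isomorphic_sym; exists freeNil_to_chiL.
apply: inj_surj_bij => [p q|u].
  move=> /(congr1 (@lieKer_val _ _ _ _)); rewrite !val_freeNil_to_chiL.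
  exact: freeNil_to_chi_inj.
have [x [p uE]] := chi_span (lieKer_val u).
exists p; apply: lieKer_inj; rewrite val_freeNil_to_chiL.
have : chi_alpha g (lieKer_val u) = 0 by case: (u) => v /= /eqP.
rewrite uE lie_morphD alpha_p // alpha_freeNil_to_chi addr0 => ->.
by rewrite linear0 add0r.
Qed.

(** As a vector space, [chi g] is [p g] plus the kernel of [alpha]. *)
Definition chi_split (u : g * freeNil K k 2) : chi g :=
  chi_p u.1 + freeNil_to_chi u.2.

Fact chi_split_linear : linear chi_split.
Proof.
move=> a [x p] [y q]; rewrite /chi_split [chi_p _]linearP.
by rewrite [freeNil_to_chi _]lie_morphD lie_morphZ /= scalerDr addrACA.
Qed.

HB.instance Definition _ :=
  GRing.isLinear.Build K (g * freeNil K k 2)%type (chi g) *:%R chi_split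
    chi_split_linear.

Lemma chi_split_bij : bijective chi_split.
Proof.
apply: inj_surj_bij => [|u]; last first.
  by have [x [p ->]] := chi_span u; exists (x, p).
apply: raddf_inj => -[x p] xp.
have {xp} xp0 : chi_p x + freeNil_to_chi p = 0 by [].
have x0 : x = 0.
  have := congr1 (chi_alpha g) xp0.
  by rewrite lie_morphD alpha_p // alpha_freeNil_to_chi addr0 lie_morph0.
move: xp0; rewrite x0 [chi_p 0]linear0 add0r -(lie_morph0 freeNil_to_chi).
by move=> /freeNil_to_chi_inj ->.
Qed.

Lemma chi_to_model_inj : injective toM.
Proof.
apply: lie_morph_inj => u; have [x [p ->]] := chi_span u.
have [ua ->] := nil_comb_surj p.
rewrite lie_morphD chi_to_model_freeNil chi_to_model_p => u0.
have x0 : x = 0.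
  have := congr1 (fun X : M => X.1.1) u0; rewrite model_comb /=.
  by rewrite addr0.
move: u0; rewrite x0 -[(0, 0, 0)]/(0 : M) add0r.
rewrite -[RHS](linear0 (nil_comb (model_q \o b))) => /model_comb_inj ->.
by rewrite !linear0 addr0.
Qed.

Lemma chi_nilpotent : nilpotent_le (chi g) 4.
Proof.
move=> u lu; apply: chi_to_model_inj; rewrite lie_morph0.
exact/chi_model_nilpotent/lie_morph_lcs.
Qed.

(** The element [[q [x, y], q [x, z]]] lies in the fourth term of the lower
    central series, as a bracket of two elements of the second one, and is sent
    to the wedge of [[x, y]] and [[x, z]]. *)
Lemma chi_not_nilpotent (x y z : g) :
    (forall a a' : K, a *: [< x, y >] + a' *: [< x, z >] = 0 ->
      a = 0 /\ a' = 0) ->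
  ~ nilpotent_le (chi g) 3.
Proof.
move=> ind nil3.
have q1 (s t : g) : lcs 1 (chi_q [< s, t >]).
  by rewrite chi_q_lbr //; apply: (@lcs_br _ _ 0).
have q3 (s t : g) (v : chi g) : lcs 1 v -> lcs 3 [< chi_q [< s, t >], v >].
  move=> lv; rewrite chi_q_lbr //.
  set u := 2 *: chi_p s; set u' := chi_q t.
  have -> : [< [< u, u' >], v >]
      = -1 *: [< u', [< u, v >] >] + [< u, [< u', v >] >].
    by rewrite [ [< u, [< u', v >] >] ]lbrA scaleN1r addrC addrK.
  by apply: (@lcs_linear _ _ 3); do 2!apply: lcs_br.
have := nil3 _ (q3 x y _ (q1 x z)).
move=> /(congr1 toM).
rewrite lie_morphE lie_morph0 !chi_to_model_q model_q_lbr.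
move=> /(congr1 (fun X : M => X.2)) /=; rewrite /gwedge => w0.
have c0 (t : g) : c t = 0 -> t = 0.
  by move=> t0; rewrite [t]bc.1 t0 big1 // => i _; rewrite mxE scale0r.
have [i ui] : exists i, c [< x, y >] 0 i != 0.
  apply/existsP; apply: contraT; rewrite negb_exists => /forallP u0.
  have [] := ind 1 0; last by move=> /eqP; rewrite oner_eq0.
  rewrite scale0r addr0 scale1r; apply: c0; apply/rowP => i.
  by rewrite [RHS]mxE; apply/eqP; rewrite -[_ == _]negbK.
(* Where the wedge of [u] and [v] vanishes, [u 0 i *: v = v 0 i *: u]. *)
have [] := ind (- c [< x, z >] 0 i) (c [< x, y >] 0 i).
  apply: c0; apply/rowP => j; rewrite linearD !linearZ_LR !mxE /= mulNr addrC.
  by rewrite -wedgeE w0 mxE.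
by move=> _ ui0; rewrite ui0 eqxx in ui.
Qed.

End Structure.

(** * Bases of free nilpotent algebras of class 2 *)

Section FreeNilBasis.
Variable K : fieldType.
Hypothesis two_neq0 : 2 != 0 :> K.

Definition abelian_rV r : lieAlgType K :=
  HB.pack_for (lieAlgType K) 'rV[K]_r
    (@Lmodule_isLieAlgebra.Build K 'rV[K]_r (fun _ _ => 0)
       (fun a _ _ _ => esym (etrans (addr0 _) (scaler0 _ a)))
       (fun a _ _ _ => esym (etrans (addr0 _) (scaler0 _ a)))
       (fun _ => erefl) (fun _ _ _ => etrans (addr0 _) (addr0 _))).

Lemma nil_comb_inj r : injective (nil_comb (@nil_gen K r)).
Proof.
have [b [c bc]] := @has_dim_basis K (abelian_rV r) r (has_dim_rV K r).
exact: (nil_comb_gen_inj bc (fun _ _ _ => erefl) two_neq0).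
Qed.

Lemma has_dim_freeNil r : has_dim (freeNil K r 2) (r + 'C(r, 2)).
Proof.
have comb_bij : bijective (nil_comb (@nil_gen K r)).
  by apply: inj_surj_bij; [exact: nil_comb_inj | exact: nil_comb_surj].
apply: has_dim_bij comb_bij _; apply: has_dim_prod (has_dim_rV K r) _.
by rewrite -card_ltpair; apply: has_dim_ffun.
Qed.

Lemma nil_gen_br_free r (i0 i1 i2 : 'I_r) a a' : (i0 < i1 < i2)%N ->
    a *: [< nil_gen K i0, nil_gen K i1 >]
    + a' *: [< nil_gen K i0, nil_gen K i2 >] = 0 ->
  a = 0 /\ a' = 0.
Proof.
move=> /andP[i01 i12]; have i02 := ltn_trans i01 i12.
pose s : ltpair r := exist _ (i0, i1) i01.
pose t : ltpair r := exist _ (i0, i2) i02.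
have st : (s == t) = false.
  by rewrite -val_eqE xpair_eqE /= eqxx -val_eqE /= ltn_eqF.
move=> e0; have /nil_comb_inj : nil_comb (@nil_gen K r)
    (a *: br_coord K s + a' *: br_coord K t) = nil_comb (@nil_gen K r) 0.
  by rewrite linearD !linearZ linear0 /= !nil_comb_br.
move=> /(congr1 snd) /ffunP /= E; split.
  have := E s; rewrite !ffunE eqxx st scaler0 addr0 => /eqP.
  by rewrite mulf_eq0 oner_eq0 orbF => /eqP.
have := E t; rewrite !ffunE eqxx eq_sym st scaler0 add0r => /eqP.
by rewrite mulf_eq0 oner_eq0 orbF => /eqP.
Qed.

End FreeNilBasis.

Local Close Scope ring_scope.

Theorem corollary1p2 (K : fieldType) (m : nat)
    (charK : (2 \notin [pchar K]%R)%N) (m_gt0 : (0 < m)%N) :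
  let h := freeNil K m 2 in
  let k := (m + 'C(m, 2))%N in
  [/\ lie_isomorphic (chiL h) (freeNil K k 2),
      has_dim (chi h) (2 * k + 'C(k, 2))%N
    & (3 <= m)%N -> nilpotency_class (chi h) 4].
Proof.
move=> h k.
have two_neq0 : (2 != 0 :> K)%R by move: charK; rewrite inE.
have h_nil2 : nil2 h := @freeNil_nil2 K m.
have h_dim : has_dim h k := has_dim_freeNil two_neq0 m.
have [b [c bc]] := has_dim_basis h_dim.
split; first exact: chiL_iso bc h_nil2 two_neq0.
  apply: has_dim_bij (chi_split_bij bc h_nil2 two_neq0) _.
  rewrite mul2n -addnn -addnA.
  exact/has_dim_prod/has_dim_freeNil.
move=> m_ge3; split=> [|d d_lt4 nil_d].
  exact: chi_nilpotent bc h_nil2 two_neq0.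
pose i n (n_lt3 : (n < 3)%N) : 'I_m := Ordinal (leq_trans n_lt3 m_ge3).
apply: (chi_not_nilpotent bc h_nil2 two_neq0 (x := nil_gen K (@i 0%N isT))
  (y := nil_gen K (@i 1%N isT)) (z := nil_gen K (@i 2%N isT))) => [a a'|].
  exact: nil_gen_br_free.
exact: nilpotent_le_leq nil_d.
Qed.
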